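(* Let $c\ge 1$, let $l,s\ge 0$ and $0\le t\le n$ be integers, and let $r_1,\dots,r_n$ be positive integers with $r_i\mid r_{i+1}$ for all $1\le i\le n-1$. Let $G=N\oplus K$ be the finitely generated abelian group with $$N=\mathbf{Z}^{(l)}\oplus\mathbf{Z}_{r_1}\oplus\cdots\oplus\mathbf{Z}_{r_t},\qquad K=\mathbf{Z}^{(s)}\oplus\mathbf{Z}_{r_{t+1}}\oplus\cdots\oplus\mathbf{Z}_{r_n},$$ and put $m=l+s$. Then $$M^{(c)}(G,N)\cong \mathbf{Z}^{(f_0)}\oplus\mathbf{Z}_{r_1}^{(f_1)}\oplus\cdots\oplus\mathbf{Z}_{r_t}^{(f_t)}\oplus\mathbf{Z}_{r_{t+1}}^{(f_{t+1}-g_{t+1})}\oplus\cdots\oplus\mathbf{Z}_{r_n}^{(f_n-g_n)},$$ where $f_0=\chi_{c+1}(m)-\chi_{c+1}(m-l)$, $f_i=\chi_{c+1}(m+n-i+1)-\chi_{c+1}(m+n-i)$ for $1\le i\le n$, and $g_i=\chi_{c+1}(m+n-l-i+1)-\chi_{c+1}(m+n-l-i)$ for $t+1\le i\le n$.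
   Context: A pair of groups $(G,N)$ is a group $G$ with a normal subgroup $N$. Commutators are left-normed: for subgroups $X,F$, $[X,\,_0F]=X$ and $[X,\,_{k+1}F]=[[X,\,_kF],F]$. For a pair $(G,N)$ and $c\ge1$, take a free presentation $1\to R\to F\to G\to 1$ ($F$ free) and let $S\le F$ be the preimage of $N$, so that $N\cong S/R$. The $c$-nilpotent multiplier of the pair is $$M^{(c)}(G,N)=\frac{R\cap[S,\,_cF]}{[R,\,_cF]}.$$ $\mathbf{Z}$ is the infinite cyclic group, $\mathbf{Z}_r$ is the cyclic group of order $r$, and $A^{(k)}$ denotes the direct sum of $k$ copies of $A$. For $k\ge1$ and $d\ge0$, $\chi_k(d)$ is given by the Witt formula: $\chi_k(d)=\frac1k\sum_{j\mid k}\mu(j)\,d^{k/j}$, where $\mu$ is the Möbius function; it is the number of basic commutators of weight $k$ on $d$ generators. *)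

(* Defs.v *)
From HB Require Import structures.
From mathcomp Require Import all_boot all_order all_algebra.
From mathcomp Require Import boolp classical_sets.

Set Implicit Arguments.
Unset Strict Implicit.
Unset Printing Implicit Defensive.

Import GRing.Theory.

Local Open Scope classical_set_scope.
Local Open Scope quotient_scope.
Local Open Scope group_scope.

Definition group_isomorphic (G H : groupType) : Prop :=
  exists f : {multiplicative G -> H}, bijective f.

Section Subgroups.
Variable G : groupType.
Implicit Types (A B H : set G) (x y : G).

Definition is_subgroup H : Prop := group_closed [in H].

Definition is_normal H : Prop :=
  is_subgroup H /\ forall x y, H x -> H (x ^ y).

Definition generated A : set G := smallest is_subgroup A.

Definition commutator A B : set G :=
  generated [set z | exists x y, [/\ A x, B y & z = [~ x, y]]].

(* [A, B, ..., B] with k occurrences of B, left-normed. *)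
Definition iter_commutator A B k : set G := iter k (commutator^~ B) A.

Lemma is_subgroupP H :
  is_subgroup H <-> H 1 /\ forall x y, H x -> H y -> H (x / y).
Proof.
rewrite /is_subgroup /group_closed /divg_closed; split=> -[H1 HF].
  split=> [|x y Hx Hy]; first exact: set_mem.
  by apply: set_mem; apply: HF; apply: mem_set.
split=> [|x y Hx Hy]; first exact: mem_set.
by apply: mem_set; apply: HF; apply: set_mem.
Qed.

Lemma is_subgroupV H x : is_subgroup H -> H x -> H x^-1.
Proof. by move=> /is_subgroupP[H1 HF] Hx; rewrite -[_^-1]mul1g; apply: HF. Qed.

Lemma is_subgroupM H x y : is_subgroup H -> H x -> H y -> H (x * y).
Proof.
move=> sH Hx Hy; rewrite -[y]invgK.
by case/is_subgroupP: (sH) => _; apply=> //; apply: is_subgroupV.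
Qed.

Lemma is_subgroupI A B :
  is_subgroup A -> is_subgroup B -> is_subgroup (A `&` B).
Proof.
move=> /is_subgroupP[A1 AF] /is_subgroupP[B1 BF]; apply/is_subgroupP.
by split=> // x y [Ax Bx] [Ay By]; split; [apply: AF | apply: BF].
Qed.

Lemma generated_subgroup A : is_subgroup (generated A).
Proof.
apply/is_subgroupP; split=> [B [/is_subgroupP[]]//|x y Ax Ay B sB].
by case: (sB) => /is_subgroupP[_ BF] _; apply: BF; [apply: Ax | apply: Ay].
Qed.

Lemma generated_normal A :
  (forall x y, A x -> A (x ^ y)) -> is_normal (generated A).
Proof.
move=> nA; split; first exact: generated_subgroup.
move=> x y Ax; suff: generated A `<=` [set z | generated A (z ^ y)] by apply.
apply: smallest_sub => [|z Az]; last first.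
  by apply: sub_gen_smallest; apply: nA.
have [g1 gF] := (is_subgroupP _).1 (generated_subgroup A).
apply/is_subgroupP; split=> [|z t /= gz gt]; first by rewrite /= conj1g.
by rewrite conjMg conjVg; apply: gF.
Qed.

Lemma commutator_normal A B :
  is_normal A -> is_normal B -> is_normal (commutator A B).
Proof.
move=> [_ nA] [_ nB]; apply: generated_normal => z g [x [y [Ax By ->]]].
by exists (x ^ g), (y ^ g); split; [exact: nA | exact: nB | rewrite conjRg].
Qed.

Lemma setT_normal : is_normal [set: G].
Proof. by split=> //; apply/is_subgroupP. Qed.

Lemma iter_commutator_normal A k :
  is_normal A -> is_normal (iter_commutator A setT k).
Proof.
move=> nA; elim: k => //= k IHk.
exact: commutator_normal IHk setT_normal.
Qed.

End Subgroups.

Record subgroup (G : groupType) := Subgroup {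
  subgroup_set :> set G;
  subgroupP : is_subgroup subgroup_set }.

Record normal_subgroup (G : groupType) := NormalSubgroup {
  normal_subgroup_set :> set G;
  normal_subgroupP : is_normal normal_subgroup_set }.

Section SubgroupType.
Variables (G : groupType) (H : subgroup G).

Definition subgroup_type := {x : G | x \in (H : set G)}.

HB.instance Definition _ := SubChoice.on subgroup_type.
HB.instance Definition _ :=
  SubChoice_isSubGroup.Build G (mem (H : set G)) subgroup_type (subgroupP H).

End SubgroupType.

Section Quotient.
Variables (G : groupType) (N : normal_subgroup G).

Let sN : is_subgroup N := (normal_subgroupP N).1.
Let nN x y : (N : set G) x -> (N : set G) (x ^ y) :=
  (normal_subgroupP N).2 x y.

Definition coset_rel (x y : G) : bool := x^-1 * y \in (N : set G).

Lemma coset_relP x y : reflect ((N : set G) (x^-1 * y)) (coset_rel x y).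
Proof. exact: asboolP. Qed.

Lemma coset_rel_refl : reflexive coset_rel.
Proof. by move=> x; apply/coset_relP; rewrite mulVg; case/is_subgroupP: sN. Qed.

Lemma coset_rel_sym : symmetric coset_rel.
Proof.
suff sub x y : coset_rel x y -> coset_rel y x.
  by move=> x y; apply/idP/idP; apply: sub.
move=> /coset_relP /(is_subgroupV sN); rewrite invgM invgK => Nyx.
exact/coset_relP.
Qed.

Lemma coset_rel_trans : transitive coset_rel.
Proof.
move=> y x z /coset_relP Nxy /coset_relP Nyz; apply/coset_relP.
by have := is_subgroupM sN Nxy Nyz; rewrite -mulgA mulVKg.
Qed.

Canonical coset_equiv :=
  EquivRel coset_rel coset_rel_refl coset_rel_sym coset_rel_trans.

Definition quotient_group := {eq_quot coset_equiv}.

HB.instance Definition _ := Choice.on quotient_group.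
HB.instance Definition _ := EqQuotient.on quotient_group.

Local Notation Q := quotient_group.

Definition quot_one : Q := \pi_Q 1.
Definition quot_inv (u : Q) : Q := \pi_Q (repr u)^-1.
Definition quot_mul (u v : Q) : Q := \pi_Q (repr u * repr v).

Lemma quot_piP x y : reflect (\pi_Q x = \pi_Q y) (coset_rel x y).
Proof. by apply: (iffP idP) => [xy|/eqquotP//]; apply/eqquotP. Qed.

Lemma coset_relM x x' y y' :
  coset_rel x x' -> coset_rel y y' -> coset_rel (x * y) (x' * y').
Proof.
move=> /coset_relP Nx /coset_relP Ny; apply/coset_relP.
have -> : (x * y)^-1 * (x' * y') = (x^-1 * x') ^ y * (y^-1 * y').
  by rewrite invgM /conjg !mulgA mulgK.
exact: is_subgroupM sN (nN _ Nx) Ny.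
Qed.

Lemma coset_relV x x' : coset_rel x x' -> coset_rel x^-1 x'^-1.
Proof.
rewrite coset_rel_sym => /coset_relP Nx; apply/coset_relP.
have -> : (x^-1)^-1 * x'^-1 = (x'^-1 * x) ^ x'^-1.
  by rewrite /conjg !invgK -!mulgA mulVKg.
exact: nN.
Qed.

Lemma repr_pi_rel x : coset_rel (repr (\pi_Q x)) x.
Proof. by apply/quot_piP; rewrite reprK. Qed.

Lemma quot_mulE x y : quot_mul (\pi_Q x) (\pi_Q y) = \pi_Q (x * y).
Proof. by apply/quot_piP; apply: coset_relM; apply: repr_pi_rel. Qed.

Lemma quot_invE x : quot_inv (\pi_Q x) = \pi_Q x^-1.
Proof. by apply/quot_piP; apply: coset_relV; apply: repr_pi_rel. Qed.

Lemma quot_mulA : associative quot_mul.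
Proof.
elim/quotW=> x; elim/quotW=> y; elim/quotW=> z.
by rewrite (quot_mulE y z) (quot_mulE x y) !quot_mulE mulgA.
Qed.

Lemma quot_mul1 : left_id quot_one quot_mul.
Proof. by elim/quotW=> x; rewrite quot_mulE mul1g. Qed.

Lemma quot_mul1r : right_id quot_one quot_mul.
Proof. by elim/quotW=> x; rewrite quot_mulE mulg1. Qed.

Lemma quot_mulV : left_inverse quot_one quot_inv quot_mul.
Proof. by elim/quotW=> x; rewrite quot_invE quot_mulE mulVg. Qed.

Lemma quot_mulVr : right_inverse quot_one quot_inv quot_mul.
Proof. by elim/quotW=> x; rewrite quot_invE quot_mulE mulgV. Qed.

HB.instance Definition _ := isGroup.Build quotient_group
  quot_mulA quot_mul1 quot_mul1r quot_mulV quot_mulVr.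

End Quotient.

Definition free_basis (F : groupType) (B : set F) : Prop :=
  forall (H : groupType) (f : F -> H),
    exists phi : {multiplicative F -> H},
      (forall b, B b -> phi b = f b) /\
      forall psi : {multiplicative F -> H},
        (forall b, B b -> psi b = f b) -> psi =1 phi.

Definition free_group (F : groupType) : Prop := exists B : set F, free_basis B.

(* A free presentation 1 -> R -> F -> G -> 1 is a surjection p : F -> G from a
   free group, with R the kernel of p; S is then the preimage of N. *)
Definition free_presentation (F G : groupType) (p : {multiplicative F -> G}) :
  Prop := free_group F /\ forall g, exists x, p x = g.

Section NilpotentMultiplier.
Variables (F G : groupType) (p : {multiplicative F -> G}).
Variables (N : normal_subgroup G) (c : nat).

Definition pres_ker : set F := p @^-1` [set 1].
Definition pres_pre : set F := p @^-1` (N : set G).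

Lemma mult_morph1 : p 1 = 1.
Proof. by apply: (mulgI (p 1)); rewrite -gmulfM !mulg1. Qed.

Lemma mult_morphV x : p x^-1 = (p x)^-1.
Proof. by apply: (mulgI (p x)); rewrite -gmulfM !mulgV mult_morph1. Qed.

Lemma preimage_normal (A : set G) : is_normal A -> is_normal (p @^-1` A).
Proof.
move=> [/is_subgroupP[A1 AF] nA]; split; last first.
  by move=> x y /= Ax; rewrite !gmulfM mult_morphV; apply: nA.
apply/is_subgroupP; split=> [|x y /= Ax Ay]; first by rewrite /= mult_morph1.
by rewrite gmulfM mult_morphV; apply: AF.
Qed.

Lemma set1_normal : is_normal [set 1 : G].
Proof.
split=> [|_ y ->]; last by rewrite /= conj1g.
by apply/is_subgroupP; split=> // _ _ -> ->; rewrite /= mulgV.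
Qed.

Lemma pres_ker_normal : is_normal pres_ker.
Proof. exact: preimage_normal set1_normal. Qed.

Lemma pres_pre_normal : is_normal pres_pre.
Proof. exact: preimage_normal (normal_subgroupP N). Qed.

Definition multiplier_num_set : set F :=
  pres_ker `&` iter_commutator pres_pre setT c.

Definition multiplier_den_set : set F := iter_commutator pres_ker setT c.

Lemma multiplier_num_subgroup : is_subgroup multiplier_num_set.
Proof.
apply: is_subgroupI; first exact: pres_ker_normal.1.
exact: (iter_commutator_normal _ pres_pre_normal).1.
Qed.

Definition multiplier_num : subgroup F := Subgroup multiplier_num_subgroup.

Lemma iter_commutator_sub (A B : set F) k :
  A `<=` B -> iter_commutator A setT k `<=` iter_commutator B setT k.
Proof.
move=> sAB; elim: k => //= k IHk; apply: sub_smallest2r.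
  exact: generated_subgroup.
by move=> z [x [y [/IHk Bx Ty ->]]]; exists x, y.
Qed.

Lemma iter_commutator_normal_sub (A : set F) k :
  is_normal A -> iter_commutator A setT k `<=` A.
Proof.
move=> nA; elim: k => //= k IHk; apply: smallest_sub; first exact: nA.1.
move=> _ [x [y [/IHk Ax _ ->]]].
by apply: (is_subgroupM nA.1); [apply: (is_subgroupV nA.1) | apply: nA.2].
Qed.

Lemma multiplier_den_sub : multiplier_den_set `<=` multiplier_num_set.
Proof.
move=> x Rx; split; first exact: (iter_commutator_normal_sub pres_ker_normal Rx).
apply: (iter_commutator_sub _ Rx) => y /= py1; rewrite /pres_pre /= py1.
by case/is_subgroupP: (normal_subgroupP N).1.
Qed.

Lemma multiplier_den_normal :
  is_normal [set x : subgroup_type multiplier_num | multiplier_den_set (val x)].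
Proof.
have [/is_subgroupP[d1 dF] dJ] := iter_commutator_normal c pres_ker_normal.
split=> [|x y /= dx]; last exact: dJ.
by apply/is_subgroupP; split=> [|x y /= dx dy]; [exact: d1 | exact: dF].
Qed.

(* [R, _c F], seen inside the group R `&` [S, _c F], which contains it by
   multiplier_den_sub. *)
Definition multiplier_den : normal_subgroup (subgroup_type multiplier_num) :=
  NormalSubgroup multiplier_den_normal.

Definition nilpotent_multiplier : groupType := quotient_group multiplier_den.

End NilpotentMultiplier.

Local Close Scope group_scope.
Local Open Scope ring_scope.

Definition direct_sum (I : finType) (A : I -> zmodType) : Type :=
  {dffun forall i, A i}.

Section DirectSum.
Variables (I : finType) (A : I -> zmodType).
Local Notation D := (direct_sum A).
Implicit Types u v w : D.

HB.instance Definition _ := Choice.on D.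

Definition dsum_zero : D := [ffun i => 0 : A i].
Definition dsum_opp u : D := [ffun i => - u i].
Definition dsum_add u v : D := [ffun i => u i + v i].

Lemma dsum_addA : associative dsum_add.
Proof. by move=> u v w; apply/ffunP=> i; rewrite !ffunE addrA. Qed.

Lemma dsum_addC : commutative dsum_add.
Proof. by move=> u v; apply/ffunP=> i; rewrite !ffunE addrC. Qed.

Lemma dsum_add0 : left_id dsum_zero dsum_add.
Proof. by move=> u; apply/ffunP=> i; rewrite !ffunE add0r. Qed.

Lemma dsum_addN : left_inverse dsum_zero dsum_opp dsum_add.
Proof. by move=> u; apply/ffunP=> i; rewrite !ffunE addNr. Qed.

HB.instance Definition _ :=
  GRing.isZmodule.Build D dsum_addA dsum_addC dsum_add0 dsum_addN.

End DirectSum.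

Definition copies (A : zmodType) (k : nat) : zmodType := {ffun 'I_k -> A}.

(* Integers modulo r, for r > 0. The type 'Z_r is not used because 'Z_1 has two
   elements. *)
Definition cyc (r : nat) : zmodType := 'I_r.-1.+1.

(* Z^(l) (+) Z_(q 0) (+) ... (+) Z_(q (k - 1)) *)
Definition fg_abelian (l k : nat) (q : nat -> nat) : zmodType :=
  (copies int l * direct_sum (fun i : 'I_k => cyc (q i)))%type.

Definition mulgrp (A : zmodType) : groupType := Algebra.to_multiplicative A.

Section DirectFactor.
Variables A B : zmodType.

Lemma left_factor_normal :
  is_normal [set x : mulgrp (A * B)%type | (x : A * B).2 = 0].
Proof.
split=> [|x y x0].
  apply/is_subgroupP; split=> // x y x0 y0.
  by change ((x : A * B).2 - (y : A * B).2 = 0); rewrite x0 y0 subr0.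
change (- (y : A * B).2 + ((x : A * B).2 + (y : A * B).2) = 0).
by rewrite x0 add0r addNr.
Qed.

Definition left_factor : normal_subgroup (mulgrp (A * B)%type) :=
  NormalSubgroup left_factor_normal.

End DirectFactor.

Definition moebius (j : nat) : int :=
  if all (fun q => logn q j == 1%N) (primes j) then (-1) ^+ size (primes j)
  else 0.

Definition witt (k d : nat) : rat :=
  k%:R^-1 * \sum_(j <- divisors k) (moebius j)%:~R * d%:R ^+ (k %/ j).

(* Main.v *)
(* Since [G] is abelian, [R] contains the derived subgroup of [F], so the
   multiplier is [S, _c F] / [R, _c F], the subgroup of degree [c + 1] of the
   free Lie ring on the abelian group [F / R] spanned by the brackets with an
   entry in [N]. Lift the generators of the cyclic summands of [G] to letters in
   [F]. The commutators bracketed along the Lyndon words of length [c + 1]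
   containing a letter of [N] generate it, by Hall's collection argument
   (Hall-Witt and the standard factorization), and such a commutator is killed
   by the order of any of its letters. Conversely, the Magnus representation of
   [F] by unitriangular integer matrices, one for each word, sends [R, _c F] to
   matrices whose top entry vanishes modulo the orders of the letters, while the
   Lie polynomial of a Lyndon word [w] is [w] plus larger words; so there are no
   further relations. It remains to count Lyndon words, which is Witt's formula
   (every word is a rotation of a power of a unique Lyndon word, then Moebius
   inversion); the order attached to a word is that of its least torsion
   index. *)

Require Import Defs.
From HB Require Import structures.
From mathcomp Require Import all_boot all_order all_algebra.
From mathcomp Require Import boolp classical_sets.
From mathcomp Require Import zify ring.

Set Implicit Arguments.
Unset Strict Implicit.
Unset Printing Implicit Defensive.

Import GRing.Theory.
Import Order.TTheory Order.DefaultSeqLexiOrder.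

(** * Lyndon words *)

(** The presentation is arbitrary: [F] may have infinite rank and its basis need not be adapted to
    [G], so the letters are mere lifts of generators and need not be free generators. Freeness
    serves to build a homomorphism into matrices from its values on the basis; there the
    superdiagonal entries are coordinates of the image in [G]. Residues in a cyclic group are
    additive only modulo its order, hence the matrix entries are controlled only by congruences,
    modulo the order attached to the target word.

    One modulus per word suffices because the Lie polynomial of a Lyndon word involves only anagrams
    of it, and the order depends only on the letters; the triangular system thus splits into blocks
    with a single modulus each. Likewise collection only permutes letters, so it preserves both the
    order and the presence of a letter of [N].

    An infinite order is encoded as modulus 0: divisibility by 0 is equality, and free and torsion
    letters need no separate treatment. No free Lie ring is constructed; coefficients of Lie
    polynomials are read off one matrix entry. *)

Lemma seq_neq0E (T : eqType) (u : seq T) : (u != [::]) = (0 < size u)%N.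
Proof. by case: u. Qed.

Lemma cat_split (T : Type) (u v x y : seq T) :
  u ++ v = x ++ y -> (size x <= size u)%N ->
  exists2 z, u = x ++ z & y = z ++ v.
Proof.
move=> E le; have defu : u = x ++ drop (size x) u.
  have /(congr1 (take (size x))) := E.
  by rewrite (take_size_cat y erefl) takel_cat // => e;
    rewrite -[LHS](cat_take_drop (size x)) e.
exists (drop (size x) u) => //; have /(congr1 (drop (size x))) := E.
by rewrite (drop_size_cat y erefl) {1}defu -catA drop_size_cat.
Qed.

Section LexicographicOrder.
Context {disp : Order.disp_t} {T : orderType disp}.
Implicit Types s t u v w : seq T.
Local Open Scope order_scope.

Lemma ltxi_catl s u v : (s ++ u < s ++ v) = (u < v).
Proof. by elim: s => //= x s IHs; rewrite eqhead_ltxiE. Qed.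

Lemma lexi_catr u s : u <= u ++ s.
Proof. by elim: u => //= x u IHu; rewrite eqhead_lexiE. Qed.

Lemma ltxi_cat u v s t : ~~ prefix u v -> u < v -> u ++ s < v ++ t.
Proof.
elim: u v => [|x u IHu] [|y v] //=; rewrite !ltxi_cons.
have [<-|] := eqVneq x y; last by case: (ltgtP x y).
by rewrite lexx /= => nuv uv; apply: IHu.
Qed.

End LexicographicOrder.

(* [lia] sees [size u] at [T] and at [Equality.sort T] as different atoms. *)
Ltac size_lia :=
  repeat match goal with
  | H : is_true (leq _ _) |- _ => revert H
  | H : is_true (andb _ _) |- _ => revert H
  | H : is_true (negb _) |- _ => revert H
  | H : @eq nat _ _ |- _ => revert H
  end;
  rewrite ?seq_neq0E ?size_cat;
  repeat match goal with |- context [@size _ ?x] => move: (size x) => ? end;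
  lia.

Section Lyndon.
Context {disp : Order.disp_t} {T : orderType disp}.
Implicit Types s t u v w : seq T.
Local Open Scope order_scope.

Definition proper_suffixes w := [seq drop i w | i <- iota 1 (size w).-1].

Definition lyndon w := (w != [::]) && all (fun s => w < s) (proper_suffixes w).

Lemma proper_suffixesP w s :
  reflect (exists2 u, w = u ++ s & (u != [::]) && (s != [::]))
          (s \in proper_suffixes w).
Proof.
apply: (iffP mapP) => [[i]|[u -> /andP[u0 s0]]].
  rewrite mem_iota => /andP[i1 iw] ->; exists (take i w).
    by rewrite cat_take_drop.
  have iw' : (i < size w)%N by lia.
  by rewrite !seq_neq0E size_take size_drop iw' subn_gt0 iw' i1.
exists (size u); last by rewrite drop_size_cat.
by move: u0 s0; rewrite mem_iota; size_lia.
Qed.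

Lemma lyndonP w :
  reflect (w != [::] /\
           forall u v, w = u ++ v -> u != [::] -> v != [::] -> w < v)
          (lyndon w).
Proof.
apply: (iffP andP) => -[w0 H]; split=> //.
  move=> u v def u0 v0; apply: (allP H); apply/proper_suffixesP.
  by exists u; rewrite // u0.
by apply/allP=> s /proper_suffixesP[u def /andP[u0 s0]]; apply: H def u0 s0.
Qed.

Lemma lyndon1 x : lyndon [:: x].
Proof. by []. Qed.

Lemma lyndon_neq0 w : lyndon w -> w != [::].
Proof. by case/lyndonP. Qed.

Lemma lyndon_suffix u v : lyndon (u ++ v) -> u != [::] -> v != [::] -> u ++ v <
  v.
Proof. by case/lyndonP=> _; apply. Qed.

Lemma lyndon_lt_left u v : lyndon (u ++ v) -> u != [::] -> v != [::] -> u < v.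
Proof.
by move=> luv u0 v0; apply: le_lt_trans (lexi_catr u v) _; apply: lyndon_suffix.
Qed.

Lemma cat_nprefix u s : u != [::] -> ~~ prefix (u ++ s) s.
Proof. by move=> u0; apply/negP=> /size_prefix; move: u0; size_lia. Qed.

Lemma lyndon_cat_lt u v : lyndon u -> lyndon v -> u < v -> u ++ v < v.
Proof.
move=> lu lv uv; have [/prefixP[s def]|nuv] := boolP (prefix u v); last first.
  by rewrite -[X in _ < X]cats0; apply: ltxi_cat.
have u0 := lyndon_neq0 lu.
have s0 : s != [::] by apply: contraTneq uv => s0; rewrite def s0 cats0 ltxx.
by rewrite def ltxi_catl; apply: lyndon_suffix => //; rewrite -def.
Qed.

(** A proper suffix inside [v] is at least [v], which exceeds [u ++ v]. Any other is [z ++ v] with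
    [z] a proper suffix of [u]; then [u < z], and [u] is too long to be a prefix of [z], so
    appending words keeps the inequality. *)
Lemma lyndon_cat u v : lyndon u -> lyndon v -> u < v -> lyndon (u ++ v).
Proof.
move=> lu lv uv; have uvv := lyndon_cat_lt lu lv uv.
have [u0 v0] := (lyndon_neq0 lu, lyndon_neq0 lv).
apply/lyndonP; split=> [|x y def x0 y0].
  by move: u0; size_lia.
have [xu|ux] := leqP (size x) (size u); last first.
  have [z defx defv] := cat_split (esym def) (ltnW ux).
  have [z0|z0] := eqVneq z [::]; first by rewrite defv z0 in uvv *.
  apply: lt_trans uvv _; rewrite {1}defv; rewrite defv in lv.
  exact: lyndon_suffix lv z0 y0.
have [z defu ->] := cat_split def xu; have [->//|z0] := eqVneq z [::].
rewrite {1}defu -catA; rewrite defu in lu.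
rewrite catA; apply: ltxi_cat (lyndon_suffix lu x0 z0).
exact: cat_nprefix.
Qed.

(** The least proper suffix is also the longest proper Lyndon suffix, so this is the usual standard
    factorization. *)
Definition std_right w := head [::] (sort <=%O (proper_suffixes w)).
Definition std_left w := take (size w - size (std_right w)) w.

(** Minimality of the right factor determines the pair, so a standard factorization can be
    recognized without computing the sort. *)
Definition std_fact u v :=
  [/\ u != [::], v != [::] & forall x y, u ++ v = x ++ y ->
      x != [::] -> y != [::] -> v <= y].

Lemma std_fact_uniq u v x y :
  u ++ v = x ++ y -> std_fact u v -> std_fact x y -> u = x /\ v = y.
Proof.
move=> def [u0 v0 Huv] [x0 y0 Hxy].
have vy : v = y.
  by apply/eqP; rewrite eq_le (Huv _ _ def) // (Hxy _ _ (esym def)).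
rewrite vy in def *; split=> //.
have sux : size u = size x by move/(congr1 size): def; size_lia.
by move/eqP: def; rewrite eqseq_cat // => /andP[/eqP].
Qed.

Lemma std_cat w : (1 < size w)%N -> std_left w ++ std_right w = w /\
  std_fact (std_left w) (std_right w).
Proof.
move=> w1.
have [v [r defs]] : exists v r, sort <=%O (proper_suffixes w) = v :: r.
  case def: (sort _ _) => [|v r]; last by exists v, r.
  have := size_sort <=%O (proper_suffixes w).
  by rewrite def size_map size_iota /=; lia.
have mem_s y : (y \in v :: r) = (y \in proper_suffixes w).
  by rewrite -defs mem_sort.
have min_v y : y \in proper_suffixes w -> v <= y.
  rewrite -mem_s in_cons => /predU1P[->//|].
  have := sort_le_sorted (proper_suffixes w); rewrite defs /=.
  by move/(order_path_min le_trans)/allP; apply.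
have /proper_suffixesP[u def /andP[u0 v0]] : v \in proper_suffixes w.
  by rewrite -mem_s mem_head.
have -> : std_right w = v by rewrite /std_right defs.
have -> : std_left w = u.
  by rewrite /std_left /std_right defs /= def size_cat addnK take_size_cat.
split=> //; split=> // x y; rewrite -def => defw x0 y0; apply: min_v.
by apply/proper_suffixesP; exists x; rewrite // x0.
Qed.

Lemma std_eq u v : std_fact u v ->
  std_left (u ++ v) = u /\ std_right (u ++ v) = v.
Proof.
move=> H; have [u0 v0 _] := H.
have uv1 : (1 < size (u ++ v))%N.
  by move: u0 v0; size_lia.
have [E S] := std_cat uv1; exact: std_fact_uniq E S H.
Qed.

(** For [v], a suffix of [v] is a suffix of [u ++ v], hence at least [v]. For [u], let [y] be a
    proper suffix with [y <= u]. If [y] is not a prefix of [u], then [y ++ v < u ++ v], against the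
    Lyndon property. If [u = y ++ z], that property gives [z ++ v < v] after cancelling [y], against
    the minimality of [v]. *)
Lemma std_fact_lyndon u v : lyndon (u ++ v) -> std_fact u v ->
  lyndon u /\ lyndon v.
Proof.
move=> luv [u0 v0 H]; split; apply/lyndonP; split=> // x y def x0 y0;
  last first.
  rewrite lt_neqAle (H (u ++ x) y) ?def ?catA // ?andbT; last first.
    by move: u0; size_lia.
  by apply: contraTneq x0 => /(congr1 size); size_lia.
have yv : u ++ v < y ++ v.
  move: luv; rewrite def -catA => luv; apply: lyndon_suffix luv x0 _.
  by move: y0; size_lia.
rewrite ltNge; apply/negP => yu.
have : ~~ prefix y u -> False.
  move=> nyu; suff : y ++ v < u ++ v by rewrite ltNge (ltW yv).
  apply: ltxi_cat => //; rewrite lt_neqAle yu andbT.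
  by apply: contraNneq nyu => ->; rewrite prefix_refl.
case: prefixP => [[z defu] _|_]; last exact.
have z0 : z != [::].
  apply: contraTneq x0 => z0; move: defu; rewrite z0 cats0 def.
  by move/(congr1 size); size_lia.
move: yv; rewrite {1}defu -catA ltxi_catl ltNge.
by rewrite (H y (z ++ v)) // ?catA -?defu //; move: z0; size_lia.
Qed.

Lemma lyndon_std w : lyndon w -> (1 < size w)%N ->
  [/\ lyndon (std_left w), lyndon (std_right w), std_left w < std_right w
    & w = std_left w ++ std_right w].
Proof.
move=> lw /std_cat[def H]; have [u0 v0 _] := H.
move: lw; rewrite -def => lw; have [lu lv] := std_fact_lyndon lw H.
by split; rewrite ?def // lyndon_lt_left.
Qed.

(** A suffix reaching into [u] is [z ++ v] with [z] a proper suffix of [u], so [z] is at least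
    [std_right u], which is at least [v]. This is the test for a bracket of Lyndon words to be
    already standard. *)
Lemma std_fact_lyndon_cat u v : lyndon u -> lyndon v -> u < v ->
  (size u == 1)%N || (v <= std_right u) -> std_fact u v.
Proof.
move=> lu lv uv H; have [u0 v0] := (lyndon_neq0 lu, lyndon_neq0 lv).
split=> // x y def x0 y0.
have [xu|ux] := leqP (size x) (size u); last first.
  have [z defx defv] := cat_split (esym def) (ltnW ux).
  have [z0|z0] := eqVneq z [::]; first by rewrite defv z0.
  by rewrite defv in lv *; apply/ltW/(lyndon_suffix lv z0 y0).
have [z defu ->] := cat_split def xu; have [->//|z0] := eqVneq z [::].
have u1 : (1 < size u)%N.
  by rewrite defu; move: x0 z0; size_lia.
move: H; rewrite gtn_eqF //= => vu.
apply: le_trans vu (le_trans _ (lexi_catr z v)).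
by have [def' [_ _ min]] := std_cat u1; apply: min x0 z0; rewrite def'.
Qed.

End Lyndon.

(** * Commutator calculus *)

Section CommutatorCalculus.
Variable F : groupType.
Local Open Scope classical_set_scope.
Local Open Scope group_scope.
Implicit Types (A N H : set F) (x y z : F).

Lemma is_subgroup1 H : is_subgroup H -> H 1.
Proof. by case/is_subgroupP. Qed.

Lemma is_subgroupVE H x : is_subgroup H -> H x^-1 <-> H x.
Proof.
by move=> sH; split=> [|]; [rewrite -{2}[x]invgK|]; apply: is_subgroupV.
Qed.

Lemma is_normalJE N x y : is_normal N -> N (x ^ y) <-> N x.
Proof.
move=> nN; split=> [Nxy|]; last exact: nN.2.
by rewrite -(conjgK y x); apply: nN.2.
Qed.

Lemma commutatorP A B x y : A x -> B y -> commutator A B [~ x, y].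
Proof. by move=> Ax By; apply: sub_gen_smallest; exists x, y. Qed.

Lemma commgMl x y z : [~ x * y, z] = [~ x, z] ^ y * [~ y, z].
Proof. by rewrite /commg /conjg !invgM -!mulgA !mulVKg. Qed.

Lemma commVg x y : [~ x^-1, y] = [~ x, y]^-1 ^ x^-1.
Proof. by rewrite /commg /conjg !invgM !invgK -!mulgA mulgV mulg1. Qed.

Lemma commg_sub_l N z : is_normal N -> is_subgroup [set x | N [~ x, z]].
Proof.
move=> nN; apply/is_subgroupP; split=> [|x y /= Nx Ny].
  by rewrite /= comm1g; apply: is_subgroup1 nN.1.
rewrite commgMl; apply: is_subgroupM nN.1 (nN.2 _ _ Nx) _.
by rewrite commVg; apply/(nN.2)/(is_subgroupV nN.1).
Qed.

Lemma commg_swap N x y : is_subgroup N -> N [~ x, y] <-> N [~ y, x].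
Proof. by move=> sN; rewrite -invgR; apply: is_subgroupVE. Qed.

Lemma commg_sub_r N z : is_normal N -> is_subgroup [set x | N [~ z, x]].
Proof.
move=> nN; have -> : [set x | N [~ z, x]] = [set x | N [~ x, z]].
  by apply/seteqP; split=> x /=; rewrite (commg_swap _ _ nN.1).
exact: commg_sub_l.
Qed.

Lemma Hall_Witt x y z :
  [~ x, y^-1, z] ^ y * [~ y, z^-1, x] ^ z * [~ z, x^-1, y] ^ x = 1.
Proof.
by rewrite /commg /conjg !invgM !invgK -!mulgA ?(mulKg, mulVKg, mulVg, mulg1).
Qed.

(** A pointwise three subgroups lemma. Hall-Witt involves inverses of [y] and [z]; the normal
    subgroups [A] and [B] absorb them, since [[~ y^-1, z^-1]] lies in [A] as soon as [[~ y, z]]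
    does. *)
Lemma commg_jacobi N A B x y z : is_normal N -> is_normal A -> is_normal B ->
  A [~ y, z] -> (forall a, A a -> N [~ a, x]) ->
  B [~ x, z] -> (forall b, B b -> N [~ b, y]) -> N [~ x, y, z].
Proof.
move=> nN nA nB Ayz NA Bxz NB.
have := Hall_Witt x y^-1 z; rewrite invgK => HW.
apply/(is_normalJE _ y^-1 nN).
have -> : [~ x, y, z] ^ y^-1 =
    ([~ y^-1, z^-1, x] ^ z * [~ z, x^-1, y^-1] ^ x)^-1.
  by apply/divg1_eq; rewrite invgK mulgA.
apply/(is_subgroupV nN.1)/(is_subgroupM nN.1); apply/(nN.2).
  apply: NA; apply: is_subgroupV (commg_sub_r y^-1 nA) _ => /=.
  by apply: is_subgroupV (commg_sub_l z nA) _.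
apply: is_subgroupV (commg_sub_r _ nN) _ => /=; apply: NB.
apply: is_subgroupV (commg_sub_r z nB) _ => /=.
exact/(commg_swap _ _ nB.1).
Qed.

(** Indices count brackets, so index [j] on the whole group is the lower central term of weight
    [j + 1]; this is the source of the successor. The induction on [j] moves one bracket from the
    second entry to the first by Jacobi, so [i] must vary. *)
Lemma commg_iter_commutator A i j x y : is_normal A ->
  iter_commutator A setT i x -> iter_commutator setT setT j y ->
  iter_commutator A setT (i + j).+1 [~ x, y].
Proof.
move=> nA; elim: j i x y => [|j IHj] i x y Ax.
  by move=> _; rewrite addn0; apply: commutatorP.
have nI k : is_normal (iter_commutator A setT k).
  exact: iter_commutator_normal.
move: y; apply: smallest_sub; first exact: commg_sub_r.
move=> _ [g [f [Gg _ ->]]].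
change (iter_commutator A setT (i + j.+1).+1 [~ x, [~ g, f]]).
apply/(commg_swap _ _ (nI _).1).
apply: (@commg_jacobi (iter_commutator A setT (i + j.+1).+1)
   (iter_commutator A setT i.+1)
   (iter_commutator A setT (i + j).+1)) => //.
- by apply/(commg_swap f x (nI i.+1).1); apply: commutatorP.
- by move=> a Aa; rewrite -addSnnS; apply: IHj.
- by apply/(commg_swap g x (nI (i + j).+1).1); apply: IHj.
- by move=> b Bb; rewrite addnS; apply: commutatorP.
Qed.

End CommutatorCalculus.

(** * Commutators along Lyndon words *)

Section StandardBracketing.
Context {disp : Order.disp_t} {T : orderType disp}.
Variables (A : Type) (gen : T -> A) (op : seq T -> seq T -> A -> A -> A).
Variable dflt : A.

(** Kept generic so that group commutators and Lie polynomials share one recursion; [op] also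
    receives the words because the Lie product needs their lengths. With fuel at least its length, a
    nonempty word never meets [dflt], both factors being shorter and nonempty. *)
Fixpoint std_rec n w : A :=
  match n, w with
  | n'.+1, [:: x] => gen x
  | n'.+1, _ => op (std_left w) (std_right w)
                   (std_rec n' (std_left w)) (std_rec n' (std_right w))
  | 0, _ => dflt
  end.

Definition std_bracket w := std_rec (size w) w.

Lemma std_sizes (w : seq T) : (1 < size w)%N ->
  [/\ (0 < size (std_left w))%N, (0 < size (std_right w))%N
    & (size (std_left w) + size (std_right w) = size w)%N].
Proof.
move=> /std_cat[def [u0 v0 _]]; rewrite -!seq_neq0E; split=> //.
by rewrite -size_cat def.
Qed.

Lemma std_recS n w : (1 < size w)%N ->
  std_rec n.+1 w = op (std_left w) (std_right w)
                      (std_rec n (std_left w)) (std_rec n (std_right w)).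
Proof. by case: w => [|y [|z s]]. Qed.

Lemma std_rec_size n w : (0 < size w <= n)%N -> std_rec n w = std_bracket w.
Proof.
elim/ltn_ind: n w => -[|n] IHn w; first by lia.
move=> wn; rewrite /std_bracket; have [w1|w1] := ltnP 1 (size w); last first.
  by case: w wn w1 => [|y [|z s]].
have [u0 v0 uv] := std_sizes w1.
case def_n: (size w) => [|m]; first by rewrite def_n in w1.
by rewrite !std_recS // !(IHn n) ?(IHn m) //; move: wn u0 v0 uv def_n; size_lia.
Qed.

Lemma std_bracket_cat u v : std_fact u v ->
  std_bracket (u ++ v) = op u v (std_bracket u) (std_bracket v).
Proof.
move=> H; have [u0 v0 _] := H; have [defu defv] := std_eq H.
rewrite !seq_neq0E in u0 v0.
have n1 : (1 < size (u ++ v))%N by size_lia.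
rewrite /std_bracket; case def_n: (size _) => [|n];
  first by rewrite def_n in n1.
rewrite std_recS // defu defv; rewrite size_cat in def_n.
by rewrite !std_rec_size //; move: u0 v0 def_n; size_lia.
Qed.

Lemma std_bracket_ind (P : seq T -> A -> Prop) :
  (forall x, P [:: x] (gen x)) ->
  (forall u v, lyndon u -> lyndon v -> std_fact u v -> lyndon (u ++ v) ->
     P u (std_bracket u) -> P v (std_bracket v) ->
     P (u ++ v) (op u v (std_bracket u) (std_bracket v))) ->
  forall w, lyndon w -> P w (std_bracket w).
Proof.
move=> P1 PM w; have [n] := ubnP (size w); elim: n w => // n IHn w wn lw.
have [w1|] := ltnP 1 (size w); last first.
  by case: w lw {wn} => [|x [|y s]].
have [lu lv _ def] := lyndon_std lw w1.
have [_ H] := std_cat w1; have [su sv suv] := std_sizes w1.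
rewrite {2}def std_bracket_cat // {1}def; apply: PM => //;
  first by rewrite -def.
  by apply: IHn => //; size_lia.
by apply: IHn => //; size_lia.
Qed.

End StandardBracketing.

Section LyndonCommutators.
Context {disp : Order.disp_t} {T : finOrderType disp}.
Variables (F : groupType) (R : set F) (x : T -> F).
Local Open Scope classical_set_scope.
Local Open Scope group_scope.
Hypotheses (nR : is_normal R) (cR : commutator setT setT `<=` R).
Implicit Types (u v w : seq T) (P : set (seq T)) (a f y z : F).

Local Notation gam := (iter_commutator (@setT F) setT).
Local Notation den := (iter_commutator R setT).

Definition lyndon_comm : seq T -> F :=
  std_bracket x (fun _ _ y z => [~ y, z]) 1.

Local Notation b := lyndon_comm.

Definition lyndon_span k P : set F :=
  generated ([set b w | w in P] `|` den k).

Lemma gam_normal k : is_normal (gam k).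
Proof. exact: iter_commutator_normal (setT_normal F). Qed.

Lemma den_normal k : is_normal (den k).
Proof. exact: iter_commutator_normal. Qed.

(** This is where commutativity of [G] enters, through [cR]: one extra commutator already lands in
    [den], so every correction of higher weight can be discarded. *)
Lemma gamS_den k : gam k.+1 `<=` den k.
Proof. by rewrite /iter_commutator iterSr; apply: iter_commutator_sub. Qed.

Lemma lyndon_comm_gam w : lyndon w -> gam (size w).-1 (b w).
Proof.
move: w; apply: (@std_bracket_ind _ _ _ _ _ _ (fun w => gam (size w).-1)) => //.
move=> u v _ _ [u0 v0 _] _ gu gv.
have -> : (size (u ++ v)).-1 = ((size u).-1 + (size v).-1).+1.
  by move: u0 v0; size_lia.
exact: commg_iter_commutator (setT_normal F) gu gv.
Qed.

Lemma span_den k P : den k `<=` lyndon_span k P.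
Proof. by move=> z dz; apply: sub_gen_smallest; right. Qed.

Lemma span_mem k P w : P w -> lyndon_span k P (b w).
Proof. by move=> Pw; apply: sub_gen_smallest; left; exists w. Qed.

Lemma span_mono k P P' : P `<=` P' -> lyndon_span k P `<=` lyndon_span k P'.
Proof.
move=> sP; apply: sub_smallest2r; first exact: generated_subgroup.
by move=> z [[w Pw <-]|dz]; [left; exists w; first exact: sP | right].
Qed.

Lemma span_gam k P :
  (forall w, P w -> lyndon w /\ size w = k.+1) -> lyndon_span k P `<=` gam k.
Proof.
move=> HP; apply: smallest_sub; first exact: (gam_normal k).1.
move=> z [[w /HP[lw sw] <-]|]; last exact: iter_commutator_sub.
by have := lyndon_comm_gam lw; rewrite sw.
Qed.

(** The span lies in [gam k], so conjugation changes its elements only by commutators in [gam k.+1],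
    which lie in [den k]. *)
Lemma span_normal k P :
  (forall w, P w -> lyndon w /\ size w = k.+1) -> is_normal (lyndon_span k P).
Proof.
move=> HP; have sS := generated_subgroup ([set b w | w in P] `|` den k).
split=> // z y Sz.
have -> : z ^ y = z * [~ z, y] by rewrite /commg mulVKg.
have dzy : den k [~ z, y].
  by apply: gamS_den; exact: (commutatorP (span_gam HP Sz) I).
exact: (is_subgroupM sS Sz (span_den dzy)).
Qed.

Lemma span_commg_l i j P (N : set F) y : is_normal N -> den (i + j).+1 `<=` N ->
  gam j y -> (forall w, P w -> N [~ b w, y]) ->
  forall z, lyndon_span i P z -> N [~ z, y].
Proof.
move=> nN dN gy NP; apply: smallest_sub; first exact: commg_sub_l.
move=> z [[w Pw <-]|dz]; first exact: NP.
by apply: dN; apply: commg_iter_commutator.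
Qed.

(** Being an anagram of [s] preserves orders and letters of [N]; the bound [m] is what the induction
    needs to continue. *)
Definition bracket_words s m : set (seq T) :=
  [set w | [/\ lyndon w, perm_eq w s & (w < m)%O]].

Lemma bracket_words_lyndon u v m : u != [::] ->
  forall w, bracket_words (u ++ v) m w ->
  lyndon w /\ size w = (size u + size v).-1.+1.
Proof.
move=> u0 w [lw /perm_size sw _]; split=> //.
by move: u0 sw; size_lia.
Qed.

(** The lexicographic order is not well-founded on all words; counting the smaller words of bounded
    length gives a measure for the induction. *)
Let rank n v := #|[pred w : n.-bseq T | ((w : seq T) < v)%O]|.

Let rank_lt n w v : (size w <= n)%N -> (w < v)%O -> (rank n w < rank n v)%N.
Proof.
move=> wn wv; apply: proper_card; apply/properP; split.
  by apply/fintype.subsetP=> s; rewrite !inE => sw; apply: lt_trans wv.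
by exists (Bseq wn); rewrite !inE ?ltxx.
Qed.

(* Unless [(u, v)] is the standard factorization of [u ++ v], write [u] as
   [u' ++ u'']; by Jacobi [[u', u''], v] comes from [[u'', v], u'] and
   [[u', v], u''], and in the brackets of words so obtained both words are less
   than [v]. Hence the induction on the length, then on the larger word [v]. *)
Theorem lyndon_comm_span u v : lyndon u -> lyndon v -> (u < v)%O ->
  lyndon_span (size u + size v).-1 (bracket_words (u ++ v) v) [~ b u, b v].
Proof.
have [n] := ubnP (size u + size v); elim: n u v => // n IHn u v.
have [m] := ubnP (rank n v); elim: m u v => // m IHm u v vm uvn lu lv uv.
have [u0 v0] := (lyndon_neq0 lu, lyndon_neq0 lv).
set N := lyndon_span _ _.
have nN : is_normal N by apply/span_normal/bracket_words_lyndon.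
have [std|] := boolP ((size u == 1)%N || (v <= std_right u)%O).
  have := std_fact_lyndon_cat lu lv uv std => fuv.
  have <- : b (u ++ v) = [~ b u, b v] by apply: std_bracket_cat.
  apply: span_mem; split=> //; first exact: lyndon_cat.
  exact: lyndon_cat_lt.
rewrite negb_or -ltNge => /andP[u1 rv].
have {}u1 : (1 < size u)%N by move: u0 u1; size_lia.
have [lu1 lu2 u12 def] := lyndon_std lu u1; have [_ fu] := std_cat u1.
move: (std_left u) (std_right u) => u' u'' in rv lu1 lu2 u12 def fu *.
have [u'0 u''0 _] := fu; have u'v := lt_trans u12 rv.
have key w s : lyndon w -> lyndon s -> (w < v)%O -> (s < v)%O ->
    perm_eq (w ++ s) (u ++ v) -> N [~ b w, b s].
  have aux w' s' : lyndon w' -> lyndon s' -> (w' < s')%O -> (s' < v)%O ->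
    perm_eq (w' ++ s') (u ++ v) -> N [~ b w', b s'].
    move=> lw ls ws sv puv; have sz := perm_size puv; rewrite !size_cat in sz.
    have w0 := lyndon_neq0 lw; rewrite /N -sz.
    apply: span_mono (IHm w' s' _ _ lw ls ws); last by rewrite sz.
      move=> t [lt pt ts]; split=> //; first exact: perm_trans puv.
      exact: lt_trans sv.
    apply: leq_trans (rank_lt _ sv) _ => //; size_lia.
  move=> lw ls wv sv puv; have [ws|sw|->] := ltgtP w s; first exact: aux.
    by apply/(commg_swap _ _ nN.1); apply: aux => //; rewrite perm_catC.
  by rewrite commgg; apply: is_subgroup1 nN.1.
have -> : b u = [~ b u', b u''] by rewrite def; apply: std_bracket_cat.
have den_N i j : (i + j).+1 = (size u + size v).-1 -> den (i + j).+1 `<=` N.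
  by move=> ->; apply: span_den.
have su : size u = (size u' + size u'')%N by rewrite def size_cat.
have sz' : (size u'' + size v < n)%N by move: uvn u'0; rewrite su; size_lia.
have sz'' : (size u' + size v < n)%N by move: uvn u''0; rewrite su; size_lia.
apply: (commg_jacobi nN _ _ (IHn _ _ sz' lu2 lv rv) _ (IHn _ _ sz'' lu1 lv
  u'v)).
- exact/span_normal/bracket_words_lyndon.
- exact/span_normal/bracket_words_lyndon.
- apply: span_commg_l (lyndon_comm_gam lu1) _ => //.
    by apply: den_N; move: u'0 u''0; rewrite su; size_lia.
  move=> w [lw pw wv]; apply: key => //; rewrite def.
  by apply: perm_trans (perm_cat pw (perm_refl u')) _; rewrite perm_catC catA.
- apply: span_commg_l (lyndon_comm_gam lu2) _ => //.
    by apply: den_N; move: u'0 u''0; rewrite su; size_lia.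
  move=> w [lw pw wv]; apply: key => //; rewrite def.
  apply: perm_trans (perm_cat pw (perm_refl u'')) _.
  by rewrite -!catA perm_cat2l perm_catC.
Qed.

End LyndonCommutators.

(** * Orders of the Lyndon commutators, and generation of [[S, _k F]] by them *)

Section LyndonGeneration.
Context {disp : Order.disp_t} {T : finOrderType disp}.
Variables (F : groupType) (R S : set F) (x : T -> F) (Nl : pred T).
Local Open Scope classical_set_scope.
Local Open Scope group_scope.
Hypotheses (nR : is_normal R) (cR : commutator setT setT `<=` R).
Hypothesis nS : is_normal S.
Implicit Types (u v w : seq T) (a f y z : F).

Local Notation gam := (iter_commutator (@setT F) setT).
Local Notation den := (iter_commutator R setT).
Local Notation num := (iter_commutator S setT).
Local Notation b := (lyndon_comm x).

Lemma iter_commutator_gam (A : set F) k : iter_commutator A setT k `<=` gam k.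
Proof. exact: iter_commutator_sub. Qed.

(** Modulo [den], the commutator is multiplicative in [y]: the defect [m] is a commutator of
    [[~ y ^+ q, z]] with [y], one bracket deeper, hence discarded by [gamS_den]. *)
Lemma commg_exp_mod i j y z q : gam i y -> gam j z ->
  exists2 n, den (i + j).+1 n & [~ y, z] ^+ q = [~ y ^+ q, z] * n.
Proof.
move=> gy gz; have nD := den_normal nR (i + j).+1.
elim: q => [|q [n dn IHq]].
  by exists 1; rewrite ?expg0 ?comm1g ?mulg1 //; apply: is_subgroup1 nD.1.
have gyq : gam i (y ^+ q).
  elim: q {n dn IHq} => [|q IHq]; first exact: is_subgroup1 (gam_normal F i).1.
  by rewrite expgS; apply: is_subgroupM (gam_normal F i).1 gy IHq.
set m := [~ [~ y ^+ q, z], y].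
have dm : den (i + j).+1 m.
  apply: gamS_den => //.
  exact: (commutatorP (commg_iter_commutator (setT_normal F) gyq gz) I).
have E : [~ y ^+ q.+1, z] = [~ y ^+ q, z] * [~ y, z] * m ^ [~ y, z].
  rewrite expgSr commgMl -[RHS]mulgA -(conjgC m) [RHS]mulgA; congr (_ * _).
  by rewrite /m; move: [~ _, z] => a; rewrite /commg mulVKg.
exists ((m ^ [~ y, z])^-1 * n ^ [~ y, z]).
  have dm' := is_subgroupV nD.1 (nD.2 _ [~ y, z] dm).
  exact: (is_subgroupM nD.1 dm' (nD.2 _ _ dn)).
rewrite E expgSr IHq; move: [~ _ ^+ _, z] [~ y, z] => a c'.
by rewrite -[RHS]mulgA mulVKg -[RHS]mulgA -(conjgC n) [RHS]mulgA.
Qed.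

Lemma commg_exp_den i j y z q : gam i y -> gam j z -> den i (y ^+ q) ->
  den (i + j).+1 ([~ y, z] ^+ q).
Proof.
move=> gy gz dy; have [n dn ->] := commg_exp_mod q gy gz.
apply: is_subgroupM (den_normal nR _).1 _ dn.
exact: commg_iter_commutator.
Qed.

(** The exponent climbs the bracketing tree from the leaf [j]: at each node the factor containing
    [j] is killed, and multiplicativity modulo [den] kills the commutator; a right factor is handled
    by inverting the commutator. *)
Lemma lyndon_comm_exp q w j : lyndon w -> j \in w -> R (x j ^+ q) ->
  den (size w).-1 (b w ^+ q).
Proof.
move=> lw jw Rq; move: w lw jw.
apply: (@std_bracket_ind _ _ _ _ _ _
  (fun w y => j \in w -> den (size w).-1 (y ^+ q))) => [i|].
  by rewrite mem_seq1 => /eqP <-.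
move=> u v lu lv [u0 v0 _] _ du dv; rewrite mem_cat.
have -> : (size (u ++ v)).-1 = ((size u).-1 + (size v).-1).+1 by size_lia.
have [gu gv] := (lyndon_comm_gam x lu, lyndon_comm_gam x lv).
case/orP=> [/du|/dv] d; first exact: commg_exp_den.
rewrite -invgR expVgn; apply: is_subgroupV (den_normal nR _).1 _.
by rewrite addnC; apply: commg_exp_den.
Qed.

Hypothesis xS : forall j, Nl j -> S (x j).

Lemma lyndon_comm_num w : lyndon w -> has Nl w -> num (size w).-1 (b w).
Proof.
move: w; apply: (@std_bracket_ind _ _ _ _ _ _
  (fun w y => has Nl w -> num (size w).-1 y)) => [i|].
  by rewrite /= orbF; apply: xS.
move=> u v lu lv [u0 v0 _] _ du dv; rewrite has_cat.
have -> : (size (u ++ v)).-1 = ((size u).-1 + (size v).-1).+1 by size_lia.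
have [gu gv] := (lyndon_comm_gam x lu, lyndon_comm_gam x lv).
case/orP=> [/du|/dv] d; first exact: commg_iter_commutator.
rewrite addnC; apply/commg_swap; first exact: (iter_commutator_normal _ nS).1.
exact: commg_iter_commutator.
Qed.

Hypothesis genF : setT `<=` generated (range x `|` R).
Hypothesis genS : S `<=` generated ([set x j | j in [set j | Nl j]] `|` R).

Definition num_words k : set (seq T) :=
  [set w | [/\ lyndon w, size w = k.+1 & has Nl w]].

(** By [genF], bracketing once more need only be done with a letter or an element of [R]. For a
    letter [lyndon_comm_span] rewrites the result in Lyndon words with the same letters, so a letter
    of [N] remains. *)
Lemma num_span k : num k `<=` lyndon_span R x k (num_words k).
Proof.
elim: k => [|k IHk] y.
  move/genS; move: y; apply: sub_smallest2r; first exact: generated_subgroup.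
  move=> y [[j Nj <-]|Ry]; last by right.
  by left; exists [:: j] => //; split; rewrite //= Nj.
have wordsP i w : num_words i w -> lyndon w /\ size w = i.+1 by case.
set N := lyndon_span _ _ _ _; have nN : is_normal N.
  exact: (span_normal x cR (wordsP k.+1)).
have dN : den k.+1 `<=` N by apply: span_den.
move: y; apply: smallest_sub; first exact: nN.1.
move=> _ [y [z [/IHk Sy _ ->]]].
have gz : gam 0 z by [].
rewrite -{1}(addn0 k) in dN.
apply: (span_commg_l nR nN dN gz _ Sy) => w [lw sw Nw].
have gw : gam k (b w) by have := lyndon_comm_gam x lw; rewrite sw.
move: (genF (I : setT z)); move: z {gz}.
apply: smallest_sub; first exact: commg_sub_r.
move=> z [[j _ <-]|Rz]; last first.
  (* Here [z] lies in [R], which is [den 0]; bracketing it with a commutator of weight [k + 1] lands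
     in [den k.+1]. *)
  apply/(commg_swap _ _ nN.1); apply: dN; rewrite addn0.
  exact: (@commg_iter_commutator _ _ 0 _ _ _ nR Rz gw).
have sub v : perm_eq v (w ++ [:: j]) -> lyndon v -> num_words k.+1 v.
  move=> pv lv; split=> //; first by rewrite (perm_size pv) size_cat sw addn1.
  by rewrite (perm_has _ pv) has_cat Nw.
have -> : x j = b [:: j] by [].
have szE : (size w + size [:: j]).-1 = k.+1 by rewrite sw addn1.
rewrite /=; have [wj|jw|->] := ltgtP w [:: j].
- have := lyndon_comm_span (x := x) nR cR lw (lyndon1 j) wj; rewrite szE.
  by apply: span_mono => v [lv pv _]; apply: sub.
- apply/(commg_swap _ _ nN.1).
  have := lyndon_comm_span (x := x) nR cR (lyndon1 j) lw jw; rewrite addnC szE.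
  apply: span_mono => v [lv pv _]; apply: sub => //.
  by apply: perm_trans pv _; rewrite (perm_catC [:: j] w).
- by rewrite commgg; apply: is_subgroup1 nN.1.
Qed.

End LyndonGeneration.

(** * The Magnus representation *)

Section Offset.
Variable k : nat.
Local Open Scope ring_scope.
Implicit Types (A B : 'M[int]_k.+1) (i j : nat) (a b c : 'I_k.+1).

(** Vanishing below the [i]-th superdiagonal plays the part of lying in the [i]-th power of the
    augmentation ideal; the [i]-th superdiagonal carries the leading term. *)
Definition offset i A := [forall a : 'I_k.+1, forall b : 'I_k.+1, (b < a + i)%N
  ==> (A a b == 0)].

Lemma offsetP i A :
  reflect (forall a b, (b < a + i)%N -> A a b = 0) (offset i A).
Proof.
apply: (iffP forallP) => H a => [b ab|].
  by have /forallP/(_ b) := H a; rewrite ab => /eqP.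
by apply/forallP=> b; apply/implyP=> ab; apply/eqP/H.
Qed.

Lemma offsetW i j A : (j <= i)%N -> offset i A -> offset j A.
Proof. by move=> ji /offsetP H; apply/offsetP=> a b ab; apply: H; lia. Qed.

Lemma offsetD i A B : offset i A -> offset i B -> offset i (A + B).
Proof.
by move=> /offsetP HA /offsetP HB; apply/offsetP=> a b ab; rewrite mxE HA ?HB.
Qed.

Lemma offsetN i A : offset i A -> offset i (- A).
Proof.
by move=> /offsetP HA; apply/offsetP=> a b ab; rewrite mxE HA ?oppr0.
Qed.

Lemma offsetB i A B : offset i A -> offset i B -> offset i (A - B).
Proof. by move=> oA oB; apply: offsetD => //; apply: offsetN. Qed.

Lemma sub_mxE A B a b : (A - B) a b = A a b - B a b.
Proof. by rewrite !mxE. Qed.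

Lemma offset1 : offset 0 (1 : 'M[int]_k.+1).
Proof.
apply/offsetP=> a b ab; rewrite mxE; case: eqP => // e.
by rewrite e in ab; lia.
Qed.

Lemma offsetM i j A B : offset i A -> offset j B -> offset (i + j) (A * B).
Proof.
move=> /offsetP HA /offsetP HB; apply/offsetP=> a b ab.
rewrite mxE big1 // => c _; have [ca|ca] := ltnP c (a + i).
  by rewrite HA // mul0r.
by rewrite HB ?mulr0 //; lia.
Qed.

(** On the leading superdiagonal of a product only one intermediate index contributes. *)
Lemma offsetM_entry i j A B a b c : offset i A -> offset j B ->
  c = (a + i)%N :> nat -> b = (c + j)%N :> nat -> (A * B) a b = A a c * B c b.
Proof.
move=> /offsetP HA /offsetP HB cE bE; rewrite mxE (bigD1 c) //= big1 ?addr0 //.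
move=> d dc; have [da|da] := ltnP d (a + i); first by rewrite HA // mul0r.
rewrite HB ?mulr0 //; have : (d : nat) != c by [].
lia.
Qed.

Lemma offset_eq0 i A : (k < i)%N -> offset i A -> A = 0.
Proof.
move=> ki /offsetP HA; apply/matrixP=> a b; rewrite mxE HA //.
by have := ltn_ord b; lia.
Qed.

Lemma offsetX i A : offset 1 A -> offset i (A ^+ i).
Proof.
move=> oA; elim: i => [|i IHi]; first by rewrite expr0 offset1.
by rewrite exprS -add1n; apply: offsetM.
Qed.

End Offset.

Section Unitriangular.
Variable k : nat.
Local Open Scope ring_scope.

Definition unitriangular : {pred 'M[int]_k.+1} := [pred A | offset 1 (A - 1)].

Lemma unitriangular1 : 1 \in unitriangular.
Proof. by rewrite inE subrr; apply/offsetP=> a b _; rewrite mxE. Qed.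

Lemma unitriangular_offset0 A : A \in unitriangular -> offset 0 A.
Proof.
by move/(offsetW (leq0n 1))/offsetD/(_ (offset1 k)); rewrite subrK.
Qed.

Lemma unitriangularM A B :
  A \in unitriangular -> B \in unitriangular -> A * B \in unitriangular.
Proof.
rewrite !inE => uA uB.
have -> : A * B - 1 = (A - 1) * B + (B - 1) by rewrite mulrBl mul1r addrA subrK.
apply: offsetD => //; apply: (@offsetM _ 1 0) => //.
exact: unitriangular_offset0.
Qed.

(** The geometric series, finite because [1 - A] is nilpotent. *)
Definition unitriangular_inv (A : 'M[int]_k.+1) := \sum_(i < k.+1) (1 - A) ^+ i.

Lemma unitriangular_mulV A : A \in unitriangular -> A * unitriangular_inv A = 1.
Proof.
move=> uA; have := subrX1 (1 - A) k.+1.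
have oA : offset 1 (1 - A) by rewrite -opprB; apply: offsetN.
rewrite (offset_eq0 (leqnn _) (offsetX _ oA)) addrAC subrr !sub0r mulNr.
by move/oppr_inj.
Qed.

Lemma unitriangularV A : A \in unitriangular -> unitriangular_inv A \in
  unitriangular.
Proof.
move=> uA; have oA : offset 1 (1 - A) by rewrite -opprB; apply: offsetN.
rewrite inE /unitriangular_inv big_ord_recl expr0 addrC addKr.
elim/big_ind: _ => [|B C|i _].
- by apply/offsetP=> a b _; rewrite mxE.
- exact: offsetD.
- by apply: offsetW (offsetX _ oA).
Qed.

Definition utmx := {A : 'M[int]_k.+1 | A \in unitriangular}.
HB.instance Definition _ := SubChoice.on utmx.

Definition ut_one : utmx := exist _ 1 unitriangular1.
Definition ut_mul (A B : utmx) : utmx :=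
  exist _ (val A * val B) (unitriangularM (valP A) (valP B)).
Definition ut_inv (A : utmx) : utmx :=
  exist _ (unitriangular_inv (val A)) (unitriangularV (valP A)).

Lemma ut_mulA : associative ut_mul.
Proof. by move=> A B C; apply: val_inj; rewrite /= mulrA. Qed.
Lemma ut_mul1 : left_id ut_one ut_mul.
Proof. by move=> A; apply: val_inj; rewrite /= mul1r. Qed.
Lemma ut_mul1r : right_id ut_one ut_mul.
Proof. by move=> A; apply: val_inj; rewrite /= mulr1. Qed.
Lemma ut_mulVr : right_inverse ut_one ut_inv ut_mul.
Proof. by move=> A; apply/val_inj/unitriangular_mulV/valP. Qed.
Lemma ut_mulV : left_inverse ut_one ut_inv ut_mul.
Proof.
by move=> A; apply: val_inj; apply: mulmx1C; apply/unitriangular_mulV/valP.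
Qed.

HB.instance Definition _ := isGroup.Build utmx
  ut_mulA ut_mul1 ut_mul1r ut_mulV ut_mulVr.

Lemma val_utM (A B : utmx) : val (A * B)%g = val A * val B.
Proof. by []. Qed.
Lemma val_ut1 : val (1%g : utmx) = 1.
Proof. by []. Qed.

End Unitriangular.

Section OffsetFiltration.
Variables (F : groupType) (k : nat) (phi : {multiplicative F -> utmx k}).
Local Open Scope classical_set_scope.
Local Open Scope ring_scope.
Implicit Types (x y : F) (a b c : 'I_k.+1) (i j q : nat).

Definition magnus x : 'M[int]_k.+1 := val (phi x) - 1.

Local Notation mu := magnus.

Lemma magnus1 : mu 1%g = 0.
Proof. by rewrite /mu mult_morph1 val_ut1 subrr. Qed.

Lemma magnus_offset x : offset 1 (mu x).
Proof. by have := valP (phi x); rewrite inE. Qed.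

Lemma val_magnus_offset x : offset 0 (val (phi x)).
Proof. exact/unitriangular_offset0/(valP (phi x)). Qed.

Lemma val_magnus x : val (phi x) = mu x + 1.
Proof. by rewrite subrK. Qed.

Lemma magnusM x y : mu (x * y)%g = mu x + mu y + mu x * mu y.
Proof.
rewrite {1}/mu gmulfM val_utM !val_magnus; move: (mu x) (mu y) => A B.
rewrite mulrDl !mulrDr !mulr1 mul1r addrA addrK.
by rewrite [RHS]addrC addrA.
Qed.

Lemma magnusF x y : mu (x / y)%g = (mu x - mu y) * val (phi y^-1%g).
Proof.
have yV : val (phi y) * val (phi y^-1%g) = 1.
  by rewrite -val_utM -gmulfM mulgV mult_morph1 val_ut1.
rewrite {1}/mu gmulfM val_utM -[X in _ - X]yV -mulrBl; congr (_ * _).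
by rewrite /mu opprB addrA subrK.
Qed.

(** From [[x, y] - 1 = (yx)^-1 (xy - yx)]: in [xy - yx] the constant and linear terms in [mu]
    cancel. *)
Lemma magnusR x y : mu [~ x, y]%g =
  val (phi (y * x)^-1%g) * (mu x * mu y - mu y * mu x).
Proof.
have yxV : val (phi (y * x)^-1%g) * val (phi (y * x)%g) = 1.
  by rewrite -val_utM -gmulfM mulVg mult_morph1 val_ut1.
rewrite -[LHS]mul1r -[X in X * _]yxV -[LHS]mulrA; congr (_ * _).
rewrite [in LHS]/mu mulrBr mulr1 -val_utM -gmulfM -commgC.
rewrite !val_magnus !magnusM; move: (mu x) (mu y) => A B.
by rewrite opprD addrACA subrr addr0 opprD addrACA [B + A]addrC subrr add0r.
Qed.

(** For [q = 1] the divisibility is void and this is the plain offset filtration, which contains the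
    lower central series; for general [q] it receives [den]. *)
Definition magnus_filtration q i : set F :=
  [set x | offset i (mu x) /\
    forall a b, b = (a + i)%N :> nat -> (q %| mu x a b)%Z].

Local Notation M := magnus_filtration.

Lemma magnus_filtration_subgroup q i : is_subgroup (M q i).
Proof.
apply/is_subgroupP; split=> [|x y [ox dx] [oy dy]].
  by split=> [|a b _]; rewrite magnus1 ?mxE ?dvdz0 //; apply/offsetP=> a b _;
    rewrite mxE.
have oxy := offsetB ox oy; split=> [|a b ab].
  by rewrite magnusF -[i]addn0; apply: offsetM oxy (val_magnus_offset _).
rewrite magnusF (offsetM_entry oxy (val_magnus_offset _) ab) ?addn0 //.
by rewrite dvdz_mulr // sub_mxE rpredB ?dx ?dy.
Qed.

Lemma magnusR_offset i j x y : offset i (mu x) -> offset j (mu y) ->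
  offset (i + j) (mu [~ x, y]%g).
Proof.
move=> ox oy; rewrite magnusR; apply: (@offsetM _ 0) (val_magnus_offset _) _.
by apply: offsetB (offsetM ox oy) _; rewrite addnC; apply: offsetM.
Qed.

(** The prefactor in [magnusR] is 1 plus a matrix of offset 1, so it does not affect the leading
    superdiagonal: there a group commutator becomes a Lie bracket. *)
Lemma magnusR_entry i j x y a b c c' : offset i (mu x) -> offset j (mu y) ->
  c = (a + i)%N :> nat -> c' = (a + j)%N :> nat -> b = (a + (i + j))%N :> nat ->
  mu [~ x, y]%g a b = mu x a c * mu y c b - mu y a c' * mu x c' b.
Proof.
move=> ox oy ac ac' ab; have o0 := val_magnus_offset (y * x)^-1%g.
have oxy : offset (i + j) (mu x * mu y - mu y * mu x).
  by apply: offsetB (offsetM ox oy) _; rewrite addnC; apply: offsetM.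
have -> : mu [~ x, y]%g = mu (y * x)^-1%g * (mu x * mu y - mu y * mu x) +
   (mu x * mu y - mu y * mu x).
  by rewrite magnusR val_magnus mulrDl mul1r.
have /offsetP o1 := offsetM (magnus_offset (y * x)^-1%g) oxy.
rewrite mxE o1 ?add0r; last by lia.
rewrite sub_mxE (offsetM_entry ox oy ac) ?(offsetM_entry oy ox ac') //; lia.
Qed.

Lemma magnus_filtrationR q i j x y :
  M q i x -> offset j (mu y) -> M q (i + j) [~ x, y]%g.
Proof.
move=> [ox dx] oy; split=> [|a b ab]; first exact: magnusR_offset.
have cb : (a + i < k.+1)%N by have := ltn_ord b; lia.
have cb' : (a + j < k.+1)%N by have := ltn_ord b; lia.
rewrite (@magnusR_entry i j _ _ _ _ (Ordinal cb) (Ordinal cb')) //.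
rewrite rpredB //; first by apply/dvdz_mulr/dx.
by apply/dvdz_mull/dx; rewrite /= ab; lia.
Qed.

Lemma gam_magnus j : iter_commutator setT setT j `<=` M 1 j.+1.
Proof.
have d1 z : (1%N %| z)%Z by exact: dvd1z.
have T x : M 1 1 x by split=> [|a b _]; [exact: magnus_offset | exact: d1].
elim: j => [|j IHj] x; first by [].
move: x; apply: smallest_sub; first exact: magnus_filtration_subgroup.
move=> _ [x [y [/IHj Mx _ ->]]]; rewrite -(addn1 j.+1).
by apply: magnus_filtrationR => //; apply: magnus_offset.
Qed.

Lemma den_magnus q (R : set F) j : R `<=` M q 1 ->
  iter_commutator R setT j `<=` M q j.+1.
Proof.
move=> RM; elim: j => [|j IHj] x; first exact: RM.
move: x; apply: smallest_sub; first exact: magnus_filtration_subgroup.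
move=> _ [x [y [/IHj Mx _ ->]]]; rewrite -(addn1 j.+1).
by apply: magnus_filtrationR => //; apply: magnus_offset.
Qed.

Lemma magnusM_entry i x y a b : offset i.+1 (mu x) -> offset i.+1 (mu y) ->
  b = (a + i.+1)%N :> nat -> mu (x * y)%g a b = mu x a b + mu y a b.
Proof.
move=> ox oy ab; have /offsetP oxy := offsetM ox oy.
by rewrite magnusM mxE [X in X + _]mxE oxy ?addr0 //; lia.
Qed.

End OffsetFiltration.

(** * Leading words of Lie polynomials and the triangular system *)

Section LieCoefficients.
Context {disp : Order.disp_t} {T : orderType disp}.
Local Open Scope ring_scope.
Implicit Types (u v w z : seq T).

(* [lie_coef w z] is the coefficient of the word [z] in the Lie polynomial
   obtained by bracketing the Lyndon word [w]. *)
Definition lie_coef : seq T -> seq T -> int :=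
  std_bracket (fun x z => (z == [:: x])%:R)
    (fun u v P Q z => P (take (size u) z) * Q (drop (size u) z) -
                      Q (take (size v) z) * P (drop (size v) z))
    (fun=> 0).

Lemma lexi_cat u v z t : size u = size z ->
  (u <= z)%O -> (v <= t)%O -> (u ++ v <= z ++ t)%O.
Proof.
move=> uz; rewrite le_eqVlt => /predU1P[->|ltuz] vt.
  by move: vt; rewrite !le_eqVlt ltxi_catl eqseq_cat // eqxx.
apply/ltW/ltxi_cat => //; apply: contraTN ltuz => /prefixP[s defz].
suff s0 : s = [::] by rewrite defz s0 cats0 ltxx.
by apply/nilP; rewrite /nilp -(eqn_add2l (size u)) -size_cat -defz uz addn0.
Qed.

Lemma lyndon_cat_rot u v : lyndon (u ++ v) -> u != [::] -> v != [::] ->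
  (u ++ v < v ++ u)%O.
Proof.
move=> luv u0 v0; rewrite -[X in (X < _)%O]cats0.
exact: ltxi_cat (cat_nprefix _ u0) (lyndon_suffix luv u0 v0).
Qed.

(** In the bracket of [u] and [v] the first product has least word [u ++ v], with coefficient 1. The
    words of the second are at least [v ++ u], which exceeds [u ++ v] because a Lyndon word is less
    than its proper rotations. *)
Lemma lie_coef_lyndon w : lyndon w -> lie_coef w w = 1 /\
  forall z, size z = size w -> lie_coef w z != 0 -> perm_eq z w /\ (w <= z)%O.
Proof.
rewrite /lie_coef; move: w; apply: (@std_bracket_ind _ _ _ _ _ _
  (fun w P => P w = 1 /\ forall z, size z = size w -> P z != 0 ->
     perm_eq z w /\ (w <= z)%O)) => [x|u v lu lv [u0 v0 _] luv [Pu Hu] [Pv Hv]].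
  by rewrite eqxx; split=> // z _; case: (z =P _) => [->|].
set P := std_bracket _ _ _ u in Pu Hu *;
  set Q := std_bracket _ _ _ v in Pv Hv *.
have split_z (f g : seq T -> int) n z : f (take n z) * g (drop n z) != 0 ->
    f (take n z) != 0 /\ g (drop n z) != 0.
  by rewrite mulf_eq0 negb_or => /andP.
have left z : size z = size (u ++ v) ->
    P (take (size u) z) * Q (drop (size u) z) != 0 ->
    perm_eq z (u ++ v) /\ (u ++ v <= z)%O.
  rewrite size_cat => sz /split_z[Pz Qz].
  have su : size (take (size u) z) = size u by rewrite size_takel // sz
    leq_addr.
  have sv : size (drop (size u) z) = size v by rewrite size_drop sz addKn.
  have [[pu lu'] [pv lv']] := (Hu _ su Pz, Hv _ sv Qz).
  by rewrite -[z](cat_take_drop (size u)); split;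
    [apply: perm_cat | apply: lexi_cat].
have right z : size z = size (u ++ v) ->
    Q (take (size v) z) * P (drop (size v) z) != 0 ->
    perm_eq z (u ++ v) /\ (u ++ v < z)%O.
  rewrite size_cat => sz /split_z[Qz Pz].
  have sv : size (take (size v) z) = size v by rewrite size_takel // sz
    leq_addl.
  have su : size (drop (size v) z) = size u by rewrite size_drop sz addnK.
  have [[pu lu'] [pv lv']] := (Hu _ su Pz, Hv _ sv Qz).
  rewrite -[z](cat_take_drop (size v)); split.
    by rewrite perm_sym perm_catC perm_sym; apply: perm_cat.
  by apply: lt_le_trans (lyndon_cat_rot luv u0 v0) _; apply: lexi_cat.
split=> [|z sz].
  rewrite take_size_cat // drop_size_cat // Pu Pv mulr1.
  have [->|nz] := eqVneq (Q (take (size v) (u ++ v)) * P (drop (size v) (u ++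
    v))) 0.
    by rewrite subr0.
  by have [_] := right _ erefl nz; rewrite ltxx.
have [->|nz _] := eqVneq (Q (take (size v) z) * P (drop (size v) z)) 0.
  by rewrite subr0; apply: left.
by have [pz /ltW lz] := right z sz nz.
Qed.

End LieCoefficients.

Section MagnusLyndon.
Context {disp : Order.disp_t} {T : finOrderType disp}.
Variables (F : groupType) (k : nat) (phi : {multiplicative F -> utmx k}).
Variables (x : T -> F) (W : seq T) (q : nat).
Local Open Scope classical_set_scope.
Local Open Scope ring_scope.
Local Notation mu := (magnus phi).
Local Notation b := (lyndon_comm x).

Hypothesis mu_x : forall j (a c : 'I_k.+1), c = a.+1 :> nat ->
  (q %| mu (x j) a c - (take 1 (drop a W) == [:: j])%:R)%Z.

Lemma lyndon_comm_offset w : lyndon w -> offset (size w) (mu (b w)).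
Proof.
move=> lw; have [ow _] := gam_magnus phi (lyndon_comm_gam x lw).
by move: ow; rewrite prednK // -seq_neq0E lyndon_neq0.
Qed.

(** On superdiagonals [magnusR_entry] obeys the recursion defining [lie_coef]: the intermediate
    indices [c1] and [c2] cut the factor of [W] starting at [a] after [size u] and [size v]
    letters. *)
Lemma lyndon_comm_magnus w : lyndon w ->
  forall a c : 'I_k.+1, c = (a + size w)%N :> nat ->
  (q %| mu (b w) a c - lie_coef w (take (size w) (drop a W)))%Z.
Proof.
rewrite /lie_coef; move: w; apply: (@std_bracket_ind _ _ _ _ _ _
  (fun w y => forall a c : 'I_k.+1, c = (a + size w)%N :> nat ->
  (q %| mu y a c - lie_coef w (take (size w) (drop a W)))%Z)) => [j a c ac|].
  by apply: mu_x; rewrite ac addn1.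
move=> u v lu lv fuv luv Hu Hv a c ac; rewrite size_cat in ac *.
have cu : (a + size u < k.+1)%N by have := ltn_ord c; lia.
have cv : (a + size v < k.+1)%N by have := ltn_ord c; lia.
pose c1 := Ordinal cu; pose c2 := Ordinal cv.
rewrite (magnusR_entry (c := c1) (c' := c2) (lyndon_comm_offset lu)
  (lyndon_comm_offset lv)) //.
have hu1 := Hu a c1 erefl; have hv1 := Hv a c2 erefl.
have hv2 : (q %| mu (b v) c1 c - lie_coef v (take (size v) (drop c1 W)))%Z.
  by apply: Hv; rewrite ac /= addnA.
have hu2 : (q %| mu (b u) c2 c - lie_coef u (take (size u) (drop c2 W)))%Z.
  by apply: Hu; rewrite ac /= addnAC addnA.
rewrite /lie_coef std_bracket_cat // -/lie_coef.
have take_u : take (size u) (take (size u + size v) (drop a W)) =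
    take (size u) (drop a W) by rewrite take_takel ?leq_addr.
have take_v : take (size v) (take (size u + size v) (drop a W)) =
    take (size v) (drop a W) by rewrite take_takel ?leq_addl.
have drop_u : drop (size u) (take (size u + size v) (drop a W)) =
    take (size v) (drop c1 W) by rewrite addnC -take_drop drop_drop addnC.
have drop_v : drop (size v) (take (size u + size v) (drop a W)) =
    take (size u) (drop c2 W) by rewrite -take_drop drop_drop addnC.
rewrite take_u take_v drop_u drop_v.
move: hu1 hv1 hu2 hv2; move: (mu _ a c1) (mu _ a c2) (mu _ c1 c) (mu _ c2 c).
move: (lie_coef _ _) (lie_coef _ _) (lie_coef _ _) (lie_coef _ _).
move=> l0 l1 l2 l3 m0 m1 m2 m3 h1 h2 h3 h4.
(* Both differences of products are telescoped, so that each summand contains one of the differences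
   known to be divisible. *)
have -> : m0 * m2 - m1 * m3 - (l3 * l0 - l2 * l1) =
  (m0 - l3) * m2 + l3 * (m2 - l0) - ((m1 - l2) * m3 + l2 * (m3 - l1)) by ring.
by apply: rpredB; apply: rpredD;
  [apply: dvdz_mulr|apply: dvdz_mull|apply: dvdz_mulr|apply: dvdz_mull].
Qed.

End MagnusLyndon.

(** The matrix of coefficients is unitriangular for the lexicographic order, so the unknowns are
    treated from the least word up. An off-diagonal coefficient is nonzero only between anagrams,
    and these share the modulus, so what is already known of smaller words applies to the equation
    of [w]. *)
Lemma lie_coef_triangular {disp : Order.disp_t} {T : orderType disp}
    (I : seq (seq T)) k (q : seq T -> nat) (z : seq T -> int) :
  uniq I -> (forall w, w \in I -> lyndon w /\ size w = k) ->
  (forall v w, perm_eq v w -> q v = q w) ->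
  (forall W, W \in I -> (q W %| \sum_(w <- I) z w * lie_coef w W)%Z)%R ->
  forall w, w \in I -> (q w %| z w)%Z.
Proof.
move=> uI HI qP H w; have [n] := ubnP (count (< w)%O I).
elim: n w => // n IHn w wn Iw; have [lw sw] := HI w Iw.
have := H w Iw; rewrite (big_rem w) //= (lie_coef_lyndon lw).1 mulr1.
suff d : (q w %| (\sum_(v <- rem w I) z v * lie_coef v w)%R)%Z by rewrite
  rpredDr.
rewrite big_seq; apply: rpred_sum => v; rewrite mem_rem_uniq // => /andP[vw Iv].
have [lv sv] := HI v Iv; have [->|nz] := eqVneq (lie_coef v w) 0.
  by rewrite mulr0 dvdz0.
have [pwv vlew] := (lie_coef_lyndon lv).2 w (etrans sw (esym sv)) nz.
rewrite (qP _ _ pwv) dvdz_mulr // IHn //.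
have vltw : (v < w)%O by rewrite lt_neqAle vlew andbT.
rewrite -ltnS; apply: leq_trans wn; rewrite ltnS.
rewrite !(permP (perm_to_rem Iv)) /= vltw ltxx add1n ltnS.
by apply: sub_count => s /= sv'; apply: lt_trans vltw.
Qed.

(** * Existence of the representation attached to a word *)

Section FreeGroup.
Variables (F : groupType) (B : set F).
Hypothesis freeB : free_basis B.
Local Open Scope classical_set_scope.

(** Freeness maps [F] into the subgroup generated by [B], fixing [B]; followed by the inclusion this
    is an endomorphism fixing [B], hence the identity by uniqueness. *)
Lemma free_basis_generated x : generated B x.
Proof.
pose H := Subgroup (generated_subgroup B).
(* Only the values on [B] matter; 1 is a default outside the subgroup. *)
pose f y : subgroup_type H := if pselect ((H : set F) y) is left Hy
  then exist _ y (mem_set Hy) else 1%g.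
have [phi [phiB _]] := freeB f.
have [psi [_ psiU]] := freeB (@idfun F).
pose vphi : {multiplicative F -> F} := val \o phi.
have vphiB y : B y -> vphi y = y.
  move=> By; rewrite /vphi /= phiB // /f; case: pselect => // -[].
  exact: sub_gen_smallest.
have : vphi x = x.
  by rewrite (psiU vphi vphiB) -(psiU [the {multiplicative F -> F} of idfun]).
by move <-; apply: set_mem; apply: valP.
Qed.

End FreeGroup.

Section MagnusExistence.
Variables (F : groupType) (B : set F) (T : eqType) (al : T -> F -> int).
Variables (m : T -> nat) (W : seq T) (q : nat).
Hypothesis freeB : free_basis B.
Local Open Scope classical_set_scope.
Local Open Scope ring_scope.
Hypothesis alM : forall j x y, (m j %| al j (x * y)%g - (al j x + al j y))%Z.
Hypothesis q_m : forall j, j \in W -> (q %| m j)%N.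

Definition letter_coef a x : int := if ohead (drop a W) is Some j then al j x
  else 0.

Definition magnus_gen k x : 'M[int]_k.+1 :=
  \matrix_(a, b) if b == a then 1 else if (b : nat) == a.+1 then letter_coef a
    x else 0.

Lemma magnus_gen_ut k x : magnus_gen k x \in @unitriangular k.
Proof.
rewrite inE; apply/offsetP=> a b ab; rewrite !mxE eq_sym.
have [_|nab] := eqVneq a b; first by rewrite subrr.
have {}nab : (a : nat) != b by [].
by rewrite ifN ?subr0 //; lia.
Qed.

Lemma letter_coefM a x y :
  (q %| letter_coef a (x * y)%g - (letter_coef a x + letter_coef a y))%Z.
Proof.
rewrite /letter_coef; case E: (drop a W) => [|j s] /=; first exact: dvdz0.
apply: dvdz_trans (alM j x y); apply: q_m; apply: (@mem_drop a).
by rewrite E mem_head.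
Qed.

(** Superdiagonal entries are exactly additive on products, while letter coordinates are additive
    only modulo [q]. They agree on the basis, so the elements where they are congruent form a
    subgroup containing it. *)
Lemma magnus_exists k : exists phi : {multiplicative F -> utmx k},
  forall x (a c : 'I_k.+1), c = a.+1 :> nat ->
    (q %| magnus phi x a c - letter_coef a x)%Z.
Proof.
have [phi [phiB _]] := freeB (fun x =>
  exist (fun A => A \in @unitriangular k) _ (magnus_gen_ut k x) : utmx k).
exists phi => x a c ac; move: x (free_basis_generated freeB x).
apply: smallest_sub; last first.
  move=> x Bx /=; rewrite /magnus phiB //= !mxE ac.
  have -> : (c == a) = false by apply/eqP=> /(congr1 val) /=; lia.
  have -> : (a == c) = false by apply/eqP=> /(congr1 val) /=; lia.
  by rewrite eqxx subr0 subrr.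
have muM x y : magnus phi (x * y)%g a c = magnus phi x a c + magnus phi y a c.
  by apply: (@magnusM_entry _ _ _ 0); rewrite ?magnus_offset ?addn1.
apply/is_subgroupP; split=> [|x y /= dx dy].
  rewrite /= magnus1 mxE sub0r rpredN.
  by have := letter_coefM a 1 1; rewrite mulg1 opprD addrA subrr sub0r rpredN.
have := letter_coefM a (x / y)%g y; have := muM (x / y)%g y; rewrite mulgVK.
move: dx dy; move: (magnus _ _ _ _) (magnus _ _ _ _) (magnus _ _ _ _).
move: (letter_coef _ _) (letter_coef _ _) (letter_coef _ _) => l1 l2 l3 n1 n2
  n3.
move=> d3 d2 E dl.
have -> : n1 - l1 = (n3 - l3) - (n2 - l2) + (l3 - (l1 + l2)) by rewrite E; ring.
by apply: rpredD => //; apply: rpredB.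
Qed.

End MagnusExistence.

(** * Integer powers *)

Section IntegerPowers.
Local Open Scope group_scope.

Definition expz (G : groupType) (x : G) (n : int) : G :=
  match n with Posz k => x ^+ k | Negz k => x ^- k.+1 end.

Variable G : groupType.
Implicit Types (x y : G) (m n : int).

Lemma expz1 x : expz x 1 = x. Proof. exact: expg1. Qed.

Lemma expzS x n : expz x (n + 1)%R = expz x n * x.
Proof.
case: n => [k|[|k]]; first by rewrite -PoszD addn1 /= expgSr.
  by rewrite /= expg1 mulVg.
have -> : (Negz k.+1 + 1)%R = Negz k by rewrite !NegzE; lia.
by rewrite /= [x ^+ k.+2]expgS invgM mulgVK.
Qed.

Lemma expzD x m n : expz x (m + n)%R = expz x m * expz x n.
Proof.
elim/int_ind: n => [|n IHn|n IHn]; first by rewrite addr0 mulg1.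
  by rewrite -addn1 PoszD addrA !expzS IHn mulgA.
apply: (mulIg x); rewrite -mulgA -!expzS -addrA.
by have -> : (- n.+1%:Z + 1 = - n%:Z)%R by lia.
Qed.

Lemma expzN x n : expz x (- n)%R = (expz x n)^-1.
Proof. by apply/esym/mulg1_eq; rewrite -expzD subrr. Qed.

Lemma commute_expz x y m n : commute x y -> commute (expz x m) (expz y n).
Proof.
have V (u v : G) : commute u v -> commute u^-1 v.
  by move=> uv; apply: commute_sym; apply: commuteV; apply: commute_sym.
by case: m n => [m|m] [n|n] xy /=; do ?[apply: V | apply: commuteV];
  apply: commuteX2.
Qed.

Lemma expz_dvd_eq1 x (q : nat) n : x ^+ q = 1 -> (q %| n)%Z -> expz x n = 1.
Proof.
move=> xq /dvdzP[t ->]; elim/int_ind: t => [|t IHt|t IHt].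
- by rewrite mul0r.
- by rewrite -addn1 PoszD mulrDl mul1r expzD IHt mul1g.
- by rewrite -addn1 PoszD opprD mulrDl expzD IHt mul1g mulN1r expzN /= xq invg1.
Qed.

Lemma is_subgroup_expz (H : set G) x n : is_subgroup H -> H x -> H (expz x n).
Proof.
move=> sH Hx; have HX k : H (x ^+ k).
  elim: k => [|k IHk]; first exact: is_subgroup1.
  by rewrite expgS; apply: is_subgroupM.
by case: n => n; [apply: HX | apply: is_subgroupV].
Qed.

End IntegerPowers.

Lemma gmulf_expz (G H : groupType) (f : {multiplicative G -> H}) (x : G) n :
  f (expz x n) = expz (f x) n.
Proof.
have fX k : f (x ^+ k)%g = (f x ^+ k)%g.
  elim: k => [|k IHk]; first exact: mult_morph1.
  by rewrite !expgS gmulfM IHk.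
by case: n => n; rewrite /= ?mult_morphV fX.
Qed.

Section AdditiveOnSubgroup.
Variables (G : groupType) (H : set G) (f : G -> int).
Hypothesis sH : is_subgroup H.
Hypothesis fM : forall x y, H x -> H y -> f (x * y)%g = (f x + f y)%R.
Local Open Scope ring_scope.

Lemma additive1 : f 1%g = 0.
Proof.
have H1 := is_subgroup1 sH.
by apply: (addIr (f 1%g)); rewrite -fM // mulg1 add0r.
Qed.

Lemma additive_expz x n : H x -> f (expz x n) = n * f x.
Proof.
move=> Hx; have HX m : H (expz x m) by apply: is_subgroup_expz.
elim/int_ind: n => [|n IHn|n IHn]; first by rewrite mul0r additive1.
  by rewrite -addn1 PoszD expzD fM // IHn expz1 mulrDl mul1r.
have E : (expz x (- n.+1%:Z) * x)%g = expz x (- n%:Z).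
  by rewrite -expzS; congr (expz x _); lia.
by apply: (addIr (f x)); rewrite -fM // E IHn -addn1 PoszD; ring.
Qed.

Lemma additive_prod (I : eqType) (r : seq I) (g : I -> G) :
  (forall i, i \in r -> H (g i)) ->
  H (\prod_(i <- r) g i)%g /\ f (\prod_(i <- r) g i)%g = \sum_(i <- r) f (g i).
Proof.
elim: r => [|i r IHr] Hg; first by rewrite !big_nil additive1; split=> //;
  apply: is_subgroup1.
have Hi : H (g i) by apply: Hg; rewrite mem_head.
have [|Hp fp] := IHr; first by move=> j jr; apply: Hg; rewrite in_cons jr orbT.
by rewrite !big_cons fM // fp; split=> //; apply: is_subgroupM.
Qed.

End AdditiveOnSubgroup.

(** * Structure of [S, _c F] modulo [R, _c F] *)

Section QuotientMorphism.
Variables (G : groupType) (N : normal_subgroup G).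
Local Open Scope group_scope.
Local Open Scope quotient_scope.

Definition quot_map (x : G) : quotient_group N := \pi_(quotient_group N) x.

Lemma quot_mapM : {morph quot_map : x y / x * y}.
Proof. by move=> x y; rewrite /quot_map -quot_mulE. Qed.

HB.instance Definition _ :=
  isMultiplicative.Build G (quotient_group N) quot_map quot_mapM.

Lemma quot_mapP x y : quot_map x = quot_map y <-> (N : set G) (x^-1 * y).
Proof. by split=> [/quot_piP/coset_relP|H] //; apply/quot_piP/coset_relP. Qed.

Lemma quot_map_eq1 x : quot_map x = 1 <-> (N : set G) x.
Proof.
have sN := (normal_subgroupP N).1.
have -> : 1 = quot_map 1 by rewrite (mult_morph1 quot_map).
by rewrite quot_mapP mulg1; apply: is_subgroupVE.
Qed.

Lemma quot_map_surj (u : quotient_group N) : exists x, quot_map x = u.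
Proof. by exists (repr u); rewrite /quot_map reprK. Qed.

End QuotientMorphism.

Section LyndonBasis.
Context {disp : Order.disp_t} {T : finOrderType disp}.
Variables (F : groupType) (B R S : set F) (x : T -> F) (Nl : pred T).
Variables (m : T -> nat) (al : T -> F -> int) (q : seq T -> nat) (c : nat).
Local Open Scope classical_set_scope.
Local Open Scope group_scope.
Hypothesis freeB : free_basis B.
Hypotheses (nR : is_normal R) (cR : commutator setT setT `<=` R).
Hypothesis nS : is_normal S.
Hypothesis xS : forall j, Nl j -> S (x j).
Hypothesis genF : setT `<=` generated (range x `|` R).
Hypothesis genS : S `<=` generated ([set x j | j in [set j | Nl j]] `|` R).
Hypothesis xR : forall j, R (x j ^+ m j).
Hypothesis alM :
  forall j y z, (m j %| (al j (y * z)%g - (al j y + al j z))%R)%Z.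
Hypothesis al_x : forall i j, (m i %| (al i (x j) - (i == j)%:R)%R)%Z.
Hypothesis al_R : forall j y, R y -> (m j %| al j y)%Z.
Hypothesis q_dvd : forall w j, j \in w -> (q w %| m j)%N.
Hypothesis q_mem : forall w, w != [::] -> exists2 j, j \in w & m j = q w.
Hypothesis q_perm : forall v w, perm_eq v w -> q v = q w.
Variable I : seq (seq T).
Hypothesis uI : uniq I.
Hypothesis mem_I : forall w, w \in I <-> num_words Nl c w.

Local Notation gam := (iter_commutator (@setT F) setT).
Local Notation den := (iter_commutator R setT).
Local Notation num := (iter_commutator S setT).
Local Notation b := (lyndon_comm x).

(** The factors follow the order of the list [I]; modulo [den] they commute, so this choice is
    harmless. *)
Definition lyndon_prod (z : seq T -> int) : F := \prod_(w <- I) expz (b w) (z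
  w).

Let mem_I_lyndon w : w \in I -> lyndon w /\ size w = c.+1.
Proof. by move/mem_I => []. Qed.

Lemma lyndon_prod_num z : num c (lyndon_prod z).
Proof.
have sN := (iter_commutator_normal c nS).1.
rewrite /lyndon_prod big_seq; elim/big_ind: _ => [|u v Hu Hv|w Iw].
- exact: is_subgroup1.
- exact: is_subgroupM.
- apply: is_subgroup_expz => //; have [lw sw Nw] := (mem_I w).1 Iw.
  by have := lyndon_comm_num nS xS lw Nw; rewrite sw.
Qed.

Let Q := NormalSubgroup (den_normal nR c).
Let pi : {multiplicative F -> quotient_group Q} := quot_map Q.

Let pi_eq1 y : pi y = 1 <-> den c y.
Proof. exact: quot_map_eq1. Qed.

Let bI_gam w : w \in I -> gam c (b w).
Proof. by case/mem_I_lyndon=> /(lyndon_comm_gam x) + sw; rewrite sw. Qed.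

Let pi_commute y z : gam c y -> commute (pi y) (pi z).
Proof.
move=> gy; rewrite /commute -!gmulfM commgC gmulfM.
have -> : pi [~ y, z] = 1; last by rewrite mulg1.
apply/pi_eq1; apply: (gamS_den cR).
by apply: commutatorP.
Qed.

Let bI_commute v w i j : v \in I ->
  commute (expz (pi (b v)) i) (expz (pi (b w)) j).
Proof. by move=> Iv; apply: commute_expz; apply: pi_commute; apply: bI_gam. Qed.

Let pi_prod z : pi (lyndon_prod z) = \prod_(w <- I) expz (pi (b w)) (z w).
Proof.
rewrite /lyndon_prod; elim: (I) => [|w s IHs];
  first by rewrite !big_nil mult_morph1.
by rewrite !big_cons gmulfM gmulf_expz IHs.
Qed.

Lemma lyndon_prodD z z' : pi (lyndon_prod (fun w => z w + z' w)%R) =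
  pi (lyndon_prod z) * pi (lyndon_prod z').
Proof.
rewrite !pi_prod !big_seq -prodgM_commute; last by move=> v w Iv _;
  apply: bI_commute.
by apply: eq_bigr => w _; apply: expzD.
Qed.

Lemma lyndon_prod_den z :
  den c (lyndon_prod z) <-> forall w, w \in I -> (q w %| z w)%Z.
Proof.
split=> [dz|qz]; last first.
  apply/pi_eq1; rewrite pi_prod big_seq big1 // => w Iw.
  apply: expz_dvd_eq1 (qz w Iw); have [lw sw] := mem_I_lyndon Iw.
  have [j jw <-] := q_mem (lyndon_neq0 lw).
  have /= <- := gmulf_expz pi (b w) (m j); apply/pi_eq1.
  by have := lyndon_comm_exp nR cR lw jw (xR j); rewrite sw.
apply: (lie_coef_triangular (k := c.+1) uI mem_I_lyndon q_perm) => W IW.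
have [lW sW] := mem_I_lyndon IW.
have q_W j : j \in W -> (q W %| m j)%N by apply: q_dvd.
have q_Wz j : j \in W -> (q W %| (m j)%:Z)%Z by rewrite dvdzE; apply: q_W.
(* Matrices have size [c + 2], so that offset [c + 1] leaves just the top right entry, where [W] is
   read in full. *)
have [phi mu_phi] := magnus_exists freeB alM q_W c.+1.
have phi_x j (a d : 'I_c.+2) : d = a.+1 :> nat ->
    (q W %| (magnus phi (x j) a d - (take 1 (drop a W) == [:: j])%:R)%R)%Z.
  move=> ad; have := mu_phi (x j) a d ad; rewrite /letter_coef.
  have aW : (a < size W)%N by rewrite sW; have := ltn_ord d; lia.
  case E: (drop a W) => [|i s] /=.
    by have := size_drop a W; rewrite E; move: aW; size_lia.
  have iW : i \in W by apply: (@mem_drop a); rewrite E mem_head.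
  have := dvdz_trans (q_Wz i iW) (al_x i j).
  rewrite take0 eqseq_cons andbT => d1 d2.
  by have := rpredD d2 d1; rewrite addrA subrK.
have R_phi : R `<=` magnus_filtration phi (q W) 1.
  move=> y Ry; split=> [|a d ad]; first exact: magnus_offset.
  rewrite addn1 in ad; have := mu_phi y a d ad; rewrite /letter_coef.
  case E: (drop a W) => [|i s] /=; first by rewrite subr0.
  have iW : i \in W by apply: (@mem_drop a); rewrite E mem_head.
  have := dvdz_trans (q_Wz i iW) (al_R i Ry) => d1 d2.
  by have := rpredD d2 d1; rewrite subrK.
have [_ /(_ ord0 ord_max erefl)] := den_magnus R_phi dz.
(* On [H] the corner entry is an exact homomorphism to the integers; it turns the product into a sum
   weighted by the exponents. *)
pose H := magnus_filtration phi 1 c.+1.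
have sH : is_subgroup H by apply: magnus_filtration_subgroup.
have tauM y y' : H y -> H y' -> magnus phi (y * y') ord0 ord_max =
    (magnus phi y ord0 ord_max + magnus phi y' ord0 ord_max)%R.
  by move=> [oy _] [oy' _]; apply: magnusM_entry oy oy' _.
have Hb w : w \in I -> H (b w) by move=> Iw; apply/gam_magnus/bI_gam.
have [w Iw|_ ->] := additive_prod sH tauM (r := I) (g := fun w => expz (b w) (z
  w)).
  by apply: is_subgroup_expz sH _; apply: Hb.
rewrite big_seq [in X in _ -> X]big_seq => d1.
suff d2 : (q W %| (\sum_(w <- I | w \in I)
    (magnus phi (expz (b w) (z w)) ord0 ord_max - z w * lie_coef w W))%R)%Z.
  by rewrite sumrB in d2; have := rpredB d1 d2; rewrite opprB addrC subrK.
apply: rpred_sum => w Iw; have [lw sw] := mem_I_lyndon Iw.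
have /= -> := additive_expz sH tauM (z w) (Hb w Iw).
rewrite -mulrBr dvdz_mull //.
have := lyndon_comm_magnus phi_x lw (a := ord0) (c := ord_max).
by rewrite drop0 take_oversize ?sw ?sW //; apply.
Qed.

Lemma lyndon_prod_eq z z' : pi (lyndon_prod z) = pi (lyndon_prod z') <->
  forall w, w \in I -> (q w %| (z w - z' w)%R)%Z.
Proof.
rewrite -(lyndon_prod_den (fun w => z w - z' w)%R) -pi_eq1.
have -> : lyndon_prod z = lyndon_prod (fun w => z' w + (z w - z' w))%R.
  by apply: eq_bigr => w _; rewrite addrC subrK.
rewrite (lyndon_prodD z' (fun w => z w - z' w)%R).
by split=> [/(canRL (mulKg _))|->]; rewrite ?mulVg ?mulg1.
Qed.

(** Elements congruent to some [lyndon_prod] form a subgroup because exponent vectors add modulo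
    [den], so it is enough to reach the generators supplied by [num_span]. *)
Lemma num_lyndon_prod y : num c y -> exists z, pi y = pi (lyndon_prod z).
Proof.
move/(num_span nR cR genF genS); move: y.
pose H : set F := [set y | exists z, pi y = pi (lyndon_prod z)].
have prod0 : pi (lyndon_prod (fun=> 0%R)) = 1.
  by rewrite pi_prod big1.
apply: (@smallest_sub _ _ _ H) => [|y [[w /mem_I Iw <-]|dy]]; last first.
- by exists (fun=> 0%R); rewrite prod0; apply/pi_eq1.
- exists (fun v => (v == w)%:R%R); rewrite pi_prod; move: uI Iw;
  elim: (I) => // v s IHs.
  rewrite big_cons /= in_cons => /andP[vs us] /predU1P[def|ws].
    rewrite -def in vs; rewrite -def eqxx expz1 big_seq big1 ?mulg1 // => u us'.
    by rewrite (negPf (memPn vs u us')).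
  by rewrite -IHs // eq_sym (negPf (memPn vs w ws)) mul1g.
apply/is_subgroupP; split=> [|y y' [z yz] [z' yz']].
  by exists (fun=> 0%R); rewrite prod0 mult_morph1.
exists (fun w => z w - z' w)%R; rewrite (lyndon_prodD z (fun w => - z' w)%R).
rewrite gmulfM yz mult_morphV yz'; congr (_ * _).
apply: mulg1_eq; rewrite -lyndon_prodD -prod0 !pi_prod.
by apply: eq_bigr => w _; rewrite subrr.
Qed.

End LyndonBasis.

(** * Witt's formula *)

Section Moebius.
Local Open Scope ring_scope.

Lemma moebius_mul_prime p j : prime p -> (0 < j)%N -> ~~ (p %| j)%N ->
  moebius (p * j) = - moebius j.
Proof.
move=> pp j0 npj.
have perm_pj : perm_eq (primes (p * j)) (p :: primes j).
  apply: uniq_perm; rewrite /= ?primes_uniq ?mem_primes ?(negPf npj) ?andbF //.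
  by move=> q; rewrite (primesM q (prime_gt0 pp) j0) primes_prime // !inE.
rewrite /moebius (perm_size perm_pj) (perm_all _ perm_pj) /=.
rewrite (lognM _ (prime_gt0 pp) j0) logn_prime // eqxx.
rewrite logn_coprime ?prime_coprime // addn0 /=.
have -> : all (fun q => logn q (p * j) == 1%N) (primes j) =
    all (fun q => logn q j == 1%N) (primes j).
  apply: eq_in_all => q; rewrite mem_primes => /and3P[pq _ qj].
  rewrite (lognM _ (prime_gt0 pp) j0) logn_prime //; case: (q =P p) => // qp.
  by rewrite -qp qj in npj.
by case: ifP => _; rewrite ?oppr0 // exprS mulN1r.
Qed.

Lemma moebius_square p j : prime p -> (0 < j)%N -> (p %| j)%N ->
  moebius (p * j) = 0.
Proof.
move=> pp j0 pj; rewrite /moebius ifN //; apply/allPn; exists p.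
  by rewrite mem_primes pp muln_gt0 prime_gt0 // j0 dvdn_mulr.
rewrite (lognM _ (prime_gt0 pp) j0) logn_prime // eqxx.
by have : (0 < logn p j)%N by [rewrite logn_gt0 mem_primes pp j0]; case: logn.
Qed.

Lemma big_divisors_dvd (R : nmodType) n k (F : nat -> R) :
  (0 < k)%N -> (n %| k)%N ->
  \sum_(j <- divisors n) F j = \sum_(j <- divisors k | (j %| n)%N) F j.
Proof.
move=> k0 nk; rewrite -[RHS]big_filter; apply: perm_big; apply: uniq_perm.
- exact: divisors_uniq.
- exact/filter_uniq/divisors_uniq.
move=> j; rewrite mem_filter -!dvdn_divisors ?(dvdn_gt0 k0 nk) //.
by case: (boolP (j %| n)%N) => // jn; rewrite (dvdn_trans jn nk).
Qed.

(** With [p] a prime factor of [n], the divisors [p * i] with [p] not dividing [i] cancel against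
    the divisors [i]; if [p] divides [i], the term is 0. *)
Lemma sum_moebius n : (0 < n)%N ->
  \sum_(j <- divisors n) moebius j = (n == 1%N)%:R.
Proof.
move=> n0; have [->|n1] := eqVneq n 1%N; first by rewrite big_seq1.
have {}n1 : (1 < n)%N by lia.
have pp := pdiv_prime n1; have := pdiv_dvd n; move: (pdiv n) pp => p pp pn.
have p0 := prime_gt0 pp;
  have np0 : (0 < n %/ p)%N by rewrite divn_gt0 // dvdn_leq.
have nE : n = (p * (n %/ p))%N by rewrite mulnC divnK.
rewrite (bigID (fun j => (p %| j)%N)) /=.
have -> : \sum_(j <- divisors n | (p %| j)%N) moebius j =
    \sum_(j <- divisors (n %/ p)) moebius (p * j).
  rewrite -[LHS]big_filter -(big_map (muln p) xpredT); apply: perm_big.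
  apply: uniq_perm; first exact/filter_uniq/divisors_uniq.
    by rewrite map_inj_uniq ?divisors_uniq // => i j /eqP;
      rewrite eqn_pmul2l // => /eqP.
  move=> j; rewrite mem_filter -dvdn_divisors //;
    apply/andP/mapP => [[pj jn]|[i]].
    exists (j %/ p)%N; last by rewrite mulnC divnK.
    by rewrite -dvdn_divisors // -(@dvdn_pmul2l p) // -nE mulnC divnK.
  by rewrite -dvdn_divisors // => ip ->; rewrite dvdn_mulr // {1}nE dvdn_pmul2l.
rewrite (bigID (fun j => (p %| j)%N)) /= big_seq_cond big1 ?add0r; last first.
  by move=> j /andP[]; rewrite -dvdn_divisors // => /(dvdn_gt0 np0);
    apply: moebius_square.
rewrite big_seq_cond (eq_bigr (fun j => - moebius j)); last first.
  by move=> j /andP[]; rewrite -dvdn_divisors // => /(dvdn_gt0 np0);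
    apply: moebius_mul_prime.
rewrite -big_seq_cond sumrN addrC; apply/eqP; rewrite subr_eq0; apply/eqP.
rewrite -[LHS]big_filter -[RHS]big_filter; apply: perm_big; apply: uniq_perm.
- exact/filter_uniq/divisors_uniq.
- exact/filter_uniq/divisors_uniq.
move=> j; rewrite !mem_filter -!dvdn_divisors //;
  case: (boolP (p %| j)%N) => //= npj.
by rewrite {1}nE Gauss_dvdr // coprime_sym prime_coprime.
Qed.

(** The factor [j] in the hypothesis stands for the rotations of a Lyndon word of length [j]; it is
    undone by the division by [k] in [witt]. *)
Lemma moebius_inversion k (L : nat -> nat) (d : nat) : (0 < k)%N ->
  (forall n, (0 < n)%N -> (\sum_(j <- divisors n) j * L j = d ^ n)%N) ->
  (L k)%:R = witt k d.
Proof.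
move=> k0 H; have kn0 : k%:R != 0 :> rat by rewrite Num.Theory.pnatr_eq0 -lt0n.
apply: (mulfI kn0); rewrite /witt mulVKf //.
transitivity (\sum_(j <- divisors k) \sum_(i <- divisors k | (i %| k %/ j)%N)
   (moebius j)%:~R * (i * L i)%:R : rat); last first.
  rewrite !big_seq; apply: eq_bigr => j; rewrite -dvdn_divisors // => jk.
  have kj0 : (0 < k %/ j)%N by rewrite divn_gt0 ?(dvdn_gt0 k0) // dvdn_leq.
  rewrite -mulr_sumr -big_divisors_dvd ?dvdn_div // -natr_sum H //.
  by rewrite natrX.
rewrite (exchange_big_dep xpredT) //=.
transitivity (\sum_(i <- divisors k) (i * L i)%:R *
    \sum_(j <- divisors (k %/ i)) (moebius j)%:~R : rat); last first.
  rewrite !big_seq; apply: eq_bigr => i; rewrite -dvdn_divisors // => ik.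
  rewrite (@big_divisors_dvd _ _ k) ?dvdn_div // mulr_sumr.
  rewrite !(big_seq_cond (fun _ => (_ %| _)%N)); apply: eq_big => [j|j _];
    last exact: mulrC.
  case: (boolP (j \in _)) => //=; rewrite -dvdn_divisors // => jk.
  by rewrite !dvdn_divRL // mulnC.
rewrite (big_rem k) /=; last by rewrite -dvdn_divisors.
rewrite divnn k0 big_seq1 mulr1 -natrM big_seq big1 ?addr0 // => i.
rewrite mem_rem_uniq ?divisors_uniq // => /andP[ik];
  rewrite -dvdn_divisors // => idk.
have i0 := dvdn_gt0 k0 idk;
  have ki0 : (0 < k %/ i)%N by rewrite divn_gt0 // dvdn_leq.
rewrite -rmorph_sum sum_moebius //.
suff -> : (k %/ i == 1)%N = false by rewrite mulr0.
apply: contra_neqF ik => /eqP k1; by rewrite -(divnK idk) k1 mul1n.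
Qed.

End Moebius.

(** * Counting Lyndon words by rotations of powers *)

Section Powers.
Variable T : eqType.
Implicit Types (u v w : seq T).

Definition word_pow e u : seq T := flatten (nseq e u).

Lemma size_word_pow e u : size (word_pow e u) = (e * size u)%N.
Proof. by rewrite size_flatten /shape map_nseq sumn_nseq mulnC. Qed.

Lemma word_powS e u : word_pow e.+1 u = u ++ word_pow e u.
Proof. by []. Qed.

Lemma all_word_pow P e u : (0 < e)%N -> all P (word_pow e u) = all P u.
Proof.
case: e => // e _; elim: e => [|e IHe]; first by rewrite /word_pow /= cats0.
by rewrite word_powS all_cat IHe andbb.
Qed.

Lemma all_rotE (P : pred T) n w : all P (rot n w) = all P w.
Proof. by rewrite -[in RHS](cat_take_drop n w) /rot !all_cat andbC. Qed.

Lemma cat_comm_pow e u w : u ++ w = w ++ u -> size w = (e * size u)%N ->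
  w = word_pow e u.
Proof.
elim: e w => [|e IHe] w E sw; first by apply/nilP; rewrite /nilp sw.
have [z def _] := cat_split (esym E) (leq_trans (leq_addr (e * size u) _)
  (eq_leq (esym sw))).
move: E sw; rewrite def -catA => /eqP;
  rewrite eqseq_cat // eqxx /= => /eqP E sw.
rewrite word_powS (IHe z E) //; apply/eqP.
by rewrite -(eqn_add2l (size u)) -size_cat sw.
Qed.

Lemma rot_mul j n w : rot j w = w -> (n * j <= size w)%N -> rot (n * j) w = w.
Proof.
move=> rj; elim: n => [|n IHn] le; first by rewrite rot0.
by rewrite mulSn rotD -?mulSn // IHn // (leq_trans _ le) // leq_mul.
Qed.

Lemma word_pow_conj e u v :
  v ++ word_pow e (u ++ v) ++ u = word_pow e.+1 (v ++ u).
Proof.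
elim: e => [|e IHe]; first by rewrite /word_pow /= cats0.
by rewrite [RHS]word_powS -IHe word_powS !catA.
Qed.

Lemma rot_word_pow e u i : (i <= size u)%N ->
  rot i (word_pow e.+1 u) = word_pow e.+1 (rot i u).
Proof.
move=> iu; have H a b : rot (size a) (word_pow e.+1 (a ++ b)) = word_pow e.+1
  (b ++ a).
  by rewrite word_powS -catA rot_size_cat -catA word_pow_conj.
by have := H (take i u) (drop i u); rewrite cat_take_drop size_takel.
Qed.

Lemma rot_rot_lt m n w : (m < size w)%N -> (n < size w)%N ->
  exists2 i, (i < size w)%N & rot m (rot n w) = rot i w.
Proof.
move=> mw nw; rewrite (rot_add_mod (ltnW nw) (ltnW mw)).
case: leqP => [|le]; last by exists (m + n - size w)%N => //; lia.
rewrite leq_eqVlt => /predU1P[->|lt]; last by exists (m + n)%N.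
by exists 0; rewrite ?rot0 ?rot_size //; lia.
Qed.

End Powers.

Section LyndonCount.
Context {disp : Order.disp_t} {T : finOrderType disp}.
Implicit Types (u v w : seq T).
Local Open Scope order_scope.

(** For the converse, suppose [w = u ++ v] with [v < w]. If [v] is not a prefix of [w], then
    [v ++ u < u ++ v], which is excluded. If [w = v ++ z], cancelling [v] in [w < v ++ u] gives
    [z < u] of equal length, so the rotation [z ++ v] would not exceed [w]. *)
Lemma lyndon_rotP w : reflect
  (w != [::] /\ forall i, (0 < i < size w)%N -> w < rot i w) (lyndon w).
Proof.
apply: (iffP idP) => [lw|[w0 H]].
  split=> [|i /andP[i0 iw]]; first exact: lyndon_neq0.
  rewrite -{1}(cat_take_drop i w); apply: lyndon_cat_rot.
  - by rewrite cat_take_drop.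
  - by rewrite seq_neq0E size_takel // ltnW.
  - by rewrite seq_neq0E size_drop subn_gt0.
have Hcat x y : w = x ++ y -> x != [::] -> y != [::] -> x ++ y < y ++ x.
  move=> def x0 y0; rewrite -[X in _ < X]rot_size_cat -def; apply: H.
  by rewrite def; move: x0 y0; size_lia.
apply/lyndonP; split=> // u v def u0 v0; have uv := Hcat _ _ def u0 v0.
rewrite ltNge le_eqVlt negb_or; apply/andP; split.
  by apply: contraTneq u0 => e; move/(congr1 size): def; rewrite e; size_lia.
apply/negP=> vw; have [/prefixP[z defw]|nvw] := boolP (prefix v w); last first.
  have := ltxi_cat u [::] nvw vw; rewrite cats0 def => vuw.
  by have := lt_trans uv vuw; rewrite ltxx.
have sz : size z = size u.
  by move/(congr1 size): def; rewrite defw; size_lia.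
have z0 : z != [::] by move: u0 sz; size_lia.
move: uv; rewrite -def defw ltxi_catl => zu.
have := Hcat _ _ defw v0 z0; rewrite -defw def ltNge => /negP; apply.
by apply: lexi_cat; rewrite // ltW.
Qed.

Lemma ltxi_word_pow e u v : size u = size v -> u < v ->
  word_pow e.+1 u < word_pow e.+1 v.
Proof.
move=> suv uv; apply: ltxi_cat => //; apply: contraTN uv => /prefixP[s def].
suff s0 : s = [::] by rewrite def s0 cats0 ltxx.
by apply/nilP; rewrite /nilp; move/(congr1 size): def; size_lia.
Qed.

Lemma lyndon_pow_lt_rot e u i : lyndon u -> (0 < i < size u)%N ->
  word_pow e.+1 u < rot i (word_pow e.+1 u).
Proof.
case/lyndon_rotP=> _ H iu; rewrite rot_word_pow;
  last by case/andP: iu => _ /ltnW.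
by apply: ltxi_word_pow; rewrite ?size_rot //; apply: H.
Qed.

Lemma rot_pow_mod e u i : u != [::] -> (i <= size (word_pow e.+1 u))%N ->
  rot i (word_pow e.+1 u) = rot (i %% size u) (word_pow e.+1 u).
Proof.
move=> u0 iu; rewrite {1}(divn_eq i (size u)) addnC rotD.
  by rewrite rot_mul // ?rot_word_pow ?rot_size // (leq_trans _ iu) //
    leq_trunc_div.
by rewrite addnC -divn_eq.
Qed.

Lemma lyndon_pow_le_rot e u i : lyndon u -> (i <= size (word_pow e.+1 u))%N ->
  word_pow e.+1 u <= rot i (word_pow e.+1 u).
Proof.
move=> lu iu; have u0 := lyndon_neq0 lu; rewrite rot_pow_mod //.
have [->|i0] := posnP (i %% size u); first by rewrite rot0.
by apply/ltW/lyndon_pow_lt_rot; rewrite // i0 ltn_mod -seq_neq0E.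
Qed.

Lemma lyndon_pow_inj e e' u u' i i' : lyndon u -> lyndon u' ->
  (e.+1 * size u = e'.+1 * size u')%N -> (i < size u)%N -> (i' < size u')%N ->
  rot i (word_pow e.+1 u) = rot i' (word_pow e'.+1 u') -> u = u' /\ i = i'.
Proof.
move=> lu lu' sz iu iu' E.
(* Each power is the least among its own rotations. The two powers are rotations of one word, so
   each is at most the other. *)
have le_pow f f' v v' j j' : lyndon v' -> (f.+1 * size v = f'.+1 * size v')%N ->
    (j < size v)%N -> (j' < size v')%N ->
    rot j (word_pow f.+1 v) = rot j' (word_pow f'.+1 v') ->
    word_pow f'.+1 v' <= word_pow f.+1 v.
  move=> lv' szv jv jv' Ev; rewrite -[word_pow f.+1 v](rotK j) Ev /rotr.
  rewrite size_rot size_word_pow.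
  have vf' : (size v' <= f'.+1 * size v')%N by rewrite leq_pmull.
  have vf : (size v <= f.+1 * size v)%N by rewrite leq_pmull.
  have [n0|n0] := posnP (f'.+1 * size v' - j)%N.
    by rewrite n0 rot0; apply: lyndon_pow_le_rot;
      rewrite // size_word_pow (leq_trans (ltnW jv')).
  have [j0|j0] := posnP j.
    rewrite j0 subn0 -{1}(size_word_pow f'.+1 v') -(size_rot j') rot_size.
    by apply: lyndon_pow_le_rot;
      rewrite // size_word_pow (leq_trans (ltnW jv')).
  have [| |n nlt ->] := @rot_rot_lt _ (f'.+1 * size v' - j) j' (word_pow f'.+1
    v').
  - by rewrite size_word_pow ltn_subrL j0 (leq_trans _ vf') // (leq_ltn_trans _
    jv').
  - by rewrite size_word_pow (leq_trans jv').
  - by apply: lyndon_pow_le_rot => //; apply: ltnW.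
have W : word_pow e.+1 u = word_pow e'.+1 u'.
  apply/eqP; rewrite eq_le (le_pow _ _ _ _ _ _ lu (esym sz) iu' iu (esym E)).
  exact: le_pow lu' sz iu iu' E.
have rot_self f v n : lyndon v -> (0 < n < size v)%N ->
    rot n (word_pow f.+1 v) <> word_pow f.+1 v.
  by move=> lv nv Ev; have := lyndon_pow_lt_rot f lv nv; rewrite Ev ltxx.
have u0 : (0 < size u)%N by rewrite -seq_neq0E lyndon_neq0.
have u'0 : (0 < size u')%N by rewrite -seq_neq0E lyndon_neq0.
(* If one root were shorter, rotating by its length would fix the common power, although a Lyndon
   root is strictly less than its proper rotations. *)
have suu : size u = size u'.
  have [lt|lt|//] := ltngtP (size u) (size u').
    have := @rot_self e' u' (size u) lu'; rewrite u0 lt -W => /(_ isT) [].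
    by rewrite rot_word_pow // rot_size.
  have := @rot_self e u (size u') lu; rewrite u'0 lt W => /(_ isT) [].
  by rewrite rot_word_pow // rot_size.
have uu : u = u'.
  by move/eqP: W; rewrite !word_powS eqseq_cat // => /andP[/eqP].
split=> //; rewrite -W in E.
have rot_neq n n' : (n < n' < size u)%N ->
    rot n (word_pow e.+1 u) <> rot n' (word_pow e.+1 u).
  move=> /andP[nn' n'u] En; apply: (@rot_self e u (n' - n)) => //.
    by rewrite subn_gt0 nn' (leq_ltn_trans (leq_subr _ _)).
  apply: (can_inj (rotK n)); rewrite -rotD subnKC ?En // ?(ltnW nn') //.
  by rewrite size_word_pow (leq_trans (ltnW n'u)) // leq_pmull.
have [lt|lt|//] := ltngtP i i'; exfalso.
  by apply: rot_neq E; rewrite lt suu.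
by apply: rot_neq (esym E); rewrite lt.
Qed.

(** Take the least rotation [v] of [w] and its least positive rotation period [j], which divides the
    length. The root of length [j] is strictly below its proper rotations: a smaller rotation
    contradicts the choice of [v], an equal one that of [j]. *)
Lemma lyndon_pow_exists w : w != [::] -> exists u i e,
  [/\ lyndon u, (i < size u)%N & w = rot i (word_pow e.+1 u)].
Proof.
move=> w0; have sw : (0 < size w)%N by rewrite -seq_neq0E.
have [i0 _ min_i0] := arg_minP (fun i : 'I_(size w) => rot i w) (P := xpredT)
  (i0 := Ordinal sw) isT.
pose v := rot i0 w; have sv : size v = size w by rewrite size_rot.
have min_v i : (i < size w)%N -> v <= rot i v.
  move=> iw; have [n nw ->] := rot_rot_lt iw (ltn_ord i0).
  exact: (min_i0 (Ordinal nw)).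
have ex_j : exists j, (0 < j)%N && (rot j v == v).
  by exists (size w); rewrite sw -sv rot_size eqxx.
have [j /andP[j0 /eqP rj] min_j] := ex_minnP ex_j.
have jw : (j <= size w)%N by apply: min_j; rewrite sw -sv rot_size eqxx.
have jdvd : (j %| size w)%N.
  apply: contraT; rewrite /dvdn -lt0n => b0.
  have ra : rot (size w %/ j * j) v = v by rewrite rot_mul // sv leq_trunc_div.
  have rb : rot (size w %% j) v = v.
    by rewrite -{1}ra -rotD addnC -divn_eq -sv ?rot_size.
  have /min_j : (0 < size w %% j)%N && (rot (size w %% j) v == v).
    by rewrite b0 rb eqxx.
  by rewrite leqNgt ltn_mod j0.
have [e se] : exists e, size w = (e.+1 * j)%N.
  by case/dvdnP: jdvd => -[|e] se; [rewrite se in sw | exists e].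
pose u := take j v; have su : size u = j by rewrite size_takel ?sv.
have E : u ++ drop j v = drop j v ++ u by rewrite cat_take_drop.
have defv : v = word_pow e.+1 u.
  rewrite word_powS -(cat_comm_pow (e := e) E) ?cat_take_drop //.
  by rewrite size_drop sv se su mulSn addKn.
have lu : lyndon u.
  apply/lyndon_rotP; rewrite seq_neq0E su; split=> // i /andP[i0' ij].
  have rotv : rot i v = word_pow e.+1 (rot i u).
    by rewrite defv rot_word_pow // su ltnW.
  have [//|lt|e_ru] := ltgtP u (rot i u).
    have := ltxi_word_pow e (size_rot i u) lt; rewrite -rotv -defv ltNge.
    by rewrite min_v // (leq_trans ij).
  have /min_j : (0 < i)%N && (rot i v == v) by rewrite i0' rotv -e_ru defv eqxx.
  by rewrite leqNgt ij.
(* Rotating by [size w - i0] undoes the rotation by [i0]; only its residue matters on a power of a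
   word of length [j]. *)
exists u, ((size w - i0) %% j)%N, e; rewrite su ltn_mod; split=> //.
rewrite -su -rot_pow_mod; last 2 first.
- exact: lyndon_neq0.
- by rewrite -defv sv leq_subr.
by rewrite -defv; have := rotK i0 w; rewrite /rotr size_rot => /esym.
Qed.

Variable P : pred T.

(** A predicate on letters, rather than a smaller ordered type, allows counts over several
    subalphabets to be compared inside one set of words. *)
Definition lyndon_words n : {set n.-tuple T} :=
  [set w : n.-tuple T | lyndon w && all P w].

Lemma card_words n : #|[set w : n.-tuple T | all P w]| = (#|P| ^ n)%N.
Proof.
rewrite -[in RHS](card_ord n) -card_ffun_on.
pose f (w : n.-tuple T) : {ffun 'I_n -> T} := [ffun i => tnth w i].
have f_inj : injective f.
  move=> v w /ffunP E; apply: eq_from_tnth => i.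
  by have := E i; rewrite !ffunE.
rewrite -(card_imset _ f_inj); apply: eq_card => g.
apply/imsetP/ffun_onP => [[w + ->] i|gP].
  by rewrite inE ffunE => /all_tnthP; apply.
exists [tuple g i | i < n].
  by rewrite inE; apply/all_tnthP=> i; rewrite tnth_mktuple; apply: gP.
by apply/ffunP=> i; rewrite ffunE tnth_mktuple.
Qed.

(** Words are sorted by the length [j] of their Lyndon root, which is unique; a root of length [j]
    has [j] distinct rotations of its power. *)
Lemma sum_lyndon n : (0 < n)%N ->
  (\sum_(j <- divisors n) j * #|lyndon_words j| = #|P| ^ n)%N.
Proof.
move=> n0; pose X j := [set w : n.-tuple T | all P w &&
  [exists u : j.-tuple T, exists i : 'I_j,
     lyndon u && (w == rot i (word_pow (n %/ j) u) :> seq T)]].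
have cardX j : (j %| n)%N -> #|X j| = (j * #|lyndon_words j|)%N.
  move=> jn; have j0 := dvdn_gt0 n0 jn.
  have nj0 : (0 < n %/ j)%N by rewrite divn_gt0 // dvdn_leq.
  have szt (p : j.-tuple T * 'I_j) : size (rot p.2 (word_pow (n %/ j) p.1)) ==
    n.
    by rewrite size_rot size_word_pow size_tuple divnK.
  pose f p := Tuple (szt p).
  have f_inj : {in finset.setX (lyndon_words j) [set: 'I_j] &, injective f}.
    move=> [u i] [u' i']; rewrite !finset.in_setX !inE /=.
    move=> /andP[/andP[lu _] _] /andP[/andP[lu' _] _] /(congr1 val) /=.
    case: (n %/ j) nj0 => // e _ E.
    have [|||/val_inj -> /val_inj -> //] :=
      lyndon_pow_inj (e := e) (e' := e) lu lu' _ _ _ E; by rewrite !size_tuple.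
  transitivity #|f @: finset.setX (lyndon_words j) [set: 'I_j]|; last first.
    by rewrite card_in_imset // cardsX cardsT card_ord mulnC.
  apply: eq_card => w; rewrite !inE; apply/andP/imsetP => [[Pw]|[[u i]]].
    case/existsP=> u /existsP[i /andP[lu /eqP defw]]; exists (u, i);
      last exact: val_inj.
    rewrite !inE lu; move: Pw; rewrite defw.
    by rewrite all_rotE all_word_pow // => ->.
  rewrite !inE => /andP[/andP[lu Pu] _] -> /=; split.
    by rewrite all_rotE all_word_pow.
  by apply/existsP; exists u; apply/existsP; exists i; rewrite lu eqxx.
rewrite -card_words -sum1_card.
transitivity (\sum_(j <- divisors n) #|X j|)%N.
  by rewrite !big_seq; apply: eq_bigr => j; rewrite -dvdn_divisors // => /cardX.
transitivity (\sum_(j <- divisors n) \sum_(w : n.-tuple T | all P w) (w \in X j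
  : nat))%N.
  apply: eq_bigr => j _; rewrite -sum1_card big_mkcond [RHS]big_mkcond /=.
  by apply: eq_bigr => w _; rewrite inE; case: (all P w) => //=;
    case: [exists _, _].
rewrite exchange_big /=; apply: eq_big => [w|w Pw]; first by rewrite inE.
have [|u [i [e [lu iu defw]]]] := @lyndon_pow_exists w.
  by rewrite seq_neq0E size_tuple.
have sw : n = (e.+1 * size u)%N.
  by rewrite -(size_tuple w) defw size_rot size_word_pow.
have u0 : (0 < size u)%N by rewrite -seq_neq0E lyndon_neq0.
have un : (size u %| n)%N by rewrite sw dvdn_mull.
rewrite (big_rem (size u)) /=; last by rewrite -dvdn_divisors.
have -> : w \in X (size u).
  rewrite inE Pw; apply/existsP; exists (in_tuple u); apply/existsP;
    exists (Ordinal iu).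
  have -> : (n %/ size u = e.+1)%N by rewrite [X in (X %/ _)%N]sw mulnK.
  by rewrite /= lu -defw eqxx.
rewrite big_seq big1 // => j;
  rewrite mem_rem_uniq ?divisors_uniq // => /andP[ju].
rewrite -dvdn_divisors // => jn; have j0 := dvdn_gt0 n0 jn.
have nj0 : (0 < n %/ j)%N by rewrite divn_gt0 // dvdn_leq.
rewrite inE Pw /=; case: existsP => // -[u' /existsP[i' /andP[lu' /eqP]]].
rewrite defw; have := divnK jn; case: (n %/ j) nj0 => // e' _ nE E.
have [|||uu _] := lyndon_pow_inj (e := e) (e' := e') lu lu' _ _ _ E => //.
- by rewrite -sw size_tuple nE.
- by rewrite size_tuple.
by rewrite uu size_tuple eqxx in ju.
Qed.

Lemma card_lyndon_words n : (0 < n)%N ->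
  (#|lyndon_words n|%:R = witt n #|P|)%R.
Proof.
move=> n0; apply: (@moebius_inversion n (fun j => #|lyndon_words j|)) => // k.
exact: sum_lyndon.
Qed.

End LyndonCount.

(** * Coordinates of finitely generated abelian groups *)

Section Cyclic.
Variable r : nat.
Hypothesis r_gt0 : (0 < r)%N.
Local Open Scope ring_scope.
Implicit Types a b : cyc r.

Lemma cycD a b : (r %| (val (a + b))%:Z - ((val a)%:Z + (val b)%:Z))%Z.
Proof.
have -> : val (a + b) = ((val a + val b) %% r)%N.
  by rewrite -[X in (_ %% X)%N](prednK r_gt0).
rewrite -PoszD -opprB rpredN -eqz_mod_dvd.
by rewrite -!modz_nat modz_mod.
Qed.

Lemma cyc_eq a b : (r %| (val a)%:Z - (val b)%:Z)%Z -> a = b.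
Proof.
have lt d : (val d < r)%N := leq_trans (ltn_ord d) (eq_leq (prednK r_gt0)).
rewrite -eqz_mod_dvd !modz_nat !modn_small // => /eqP[ab].
exact: val_inj.
Qed.

Definition cyc_of (z : int) : cyc r := inZp `|(z %% r)%Z|%N.

Lemma cyc_ofE z : (r %| (val (cyc_of z))%:Z - z)%Z.
Proof.
rewrite -eqz_mod_dvd /= prednK // -modz_nat modz_mod.
by rewrite gez0_abs ?modz_ge0 ?modz_mod // -lt0n.
Qed.

End Cyclic.

Section FgAbelian.
Variables (l k : nat) (q : nat -> nat).
Hypothesis q_gt0 : forall i : 'I_k, (0 < q i)%N.
Local Open Scope ring_scope.
Local Notation A := (fg_abelian l k q).
Local Notation Y := ('I_l + 'I_k)%type.
Implicit Types (a b : A) (y : Y).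

Definition fg_free a (i : 'I_l) : int := (a.1 : copies int l) i.
Definition fg_tors a (i : 'I_k) : cyc (q i) :=
  (a.2 : direct_sum (fun i : 'I_k => cyc (q i))) i.

Definition fg_coord y a : int :=
  match y with inl i => fg_free a i | inr i => (val (fg_tors a i))%:Z end.

(** Modulus 0 marks an infinite summand, where a congruence is an equality. *)
Definition fg_mod y : nat := if y is inr i then q i else 0.

Definition fg_of (z : Y -> int) : A :=
  ([ffun i => z (inl i)], [ffun i : 'I_k => cyc_of (q i) (z (inr i))]).

Lemma fg_freeD a b i : fg_free (a + b) i = fg_free a i + fg_free b i.
Proof. by rewrite /fg_free /= !ffunE. Qed.

Lemma fg_torsD a b i : fg_tors (a + b) i = fg_tors a i + fg_tors b i.
Proof. by rewrite /fg_tors /= !ffunE. Qed.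

Lemma fg_coordD y a b :
  (fg_mod y %| fg_coord y (a + b) - (fg_coord y a + fg_coord y b))%Z.
Proof.
case: y => i /=; first by rewrite fg_freeD subrr.
by rewrite fg_torsD; apply: cycD.
Qed.

Lemma fg_coord0 y : fg_coord y 0 = 0.
Proof. by case: y => i; rewrite /= /fg_free /fg_tors /= ffunE. Qed.

Lemma fg_coord_eq a b :
  (forall y, (fg_mod y %| fg_coord y a - fg_coord y b)%Z) -> a = b.
Proof.
move=> H; case: a b H => [a1 a2] [b1 b2] H; congr (_, _).
  by apply/ffunP=> i; have := H (inl i); rewrite /= dvd0z subr_eq0 => /eqP.
by apply/ffunP=> i; have := H (inr i); apply: cyc_eq.
Qed.

Lemma fg_coord_of z y : (fg_mod y %| fg_coord y (fg_of z) - z y)%Z.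
Proof.
case: y => i; rewrite /= /fg_free /fg_tors /= ffunE; first by rewrite subrr.
exact: cyc_ofE.
Qed.

Definition fg_gen y : A := fg_of (fun y' => (y' == y)%:R).

End FgAbelian.

Section Coordinates.
Variables (A : zmodType) (X : finType).
Variables (coord : X -> A -> int) (md : X -> nat) (gen : X -> A).
Local Open Scope ring_scope.
Implicit Types (a b : A) (x y : X).
Hypothesis coordD : forall x a b,
  (md x %| coord x (a + b) - (coord x a + coord x b))%Z.
Hypothesis coord_eq : forall a b,
  (forall x, (md x %| coord x a - coord x b)%Z) -> a = b.
Hypothesis coord_gen : forall x y, (md x %| coord x (gen y) - (x == y)%:R)%Z.

Lemma coord_zero x : (md x %| coord x 0)%Z.
Proof. by have := coordD x 0 0;
  rewrite addr0 opprD addrA subrr sub0r rpredN. Qed.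

Lemma coordMn x a n : (md x %| coord x (a *+ n) - coord x a * n%:Z)%Z.
Proof.
elim: n => [|n IHn]; first by rewrite mulr0n mulr0 subr0 coord_zero.
have := rpredD (coordD x a (a *+ n)) IHn; rewrite -mulrS; congr (_ %| _)%Z.
by rewrite -addn1 PoszD; ring.
Qed.

Lemma coordN x a : (md x %| coord x (- a) + coord x a)%Z.
Proof.
have := rpredB (coord_zero x) (coordD x a (- a));
  rewrite subrr opprB addrC subrK.
by rewrite addrC.
Qed.

Lemma coordMz x a (n : int) : (md x %| coord x (a *~ n) - coord x a * n)%Z.
Proof.
case: n => n; first exact: coordMn.
have := rpredB (coordN x (a *+ n.+1)) (coordMn x a n.+1).
by congr (_ %| _)%Z; rewrite NegzE mulrNz -pmulrn; ring.
Qed.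

Lemma coord_sum x (I : Type) (s : seq I) (P : pred I) (f : I -> A) :
  (md x %| coord x (\sum_(i <- s | P i) f i) - \sum_(i <- s | P i) coord x (f
    i))%Z.
Proof.
elim/big_rec2: _ => [|i z a _ IH]; first by rewrite subr0 coord_zero.
have := rpredD (coordD x (f i) a) IH; congr (_ %| _)%Z.
ring.
Qed.

Lemma coord_decomp a : a = \sum_x gen x *~ coord x a.
Proof.
apply: coord_eq => x; rewrite -opprB rpredN.
have := coord_sum x (index_enum X) xpredT (fun y => gen y *~ coord y a).
have d : (md x %| \sum_y (coord x (gen y *~ coord y a) - (x == y)%:R * coord y
  a))%Z.
  apply: rpred_sum => y _.
  have := rpredD (coordMz x (gen y) (coord y a)) (dvdz_mulr (coord y a)
    (coord_gen x y)).
  by congr (_ %| _)%Z; ring.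
have e : \sum_y (x == y)%:R * coord y a = coord x a.
  rewrite (bigD1 x) //= eqxx mul1r big1 ?addr0 // => y.
  by rewrite eq_sym => /negPf ->; rewrite mul0r.
by move=> /rpredD/(_ d); rewrite sumrB addrA subrK e.
Qed.

Lemma gen_order x : gen x *+ md x = 0.
Proof.
apply: coord_eq => y.
have d : (md y %| coord y (gen x) * (md x)%:Z)%Z.
  have [->|yx] := eqVneq y x; first by rewrite dvdz_mull.
  by have := dvdz_mulr (md x)%:Z (coord_gen y x); rewrite (negPf yx) subr0.
have := rpredD (rpredB (coordMn y (gen x) (md x)) (coord_zero y)) d.
by congr (_ %| _)%Z; ring.
Qed.

End Coordinates.

(** * The multiplier of an abelian pair *)

Lemma bijective_group_isomorphic (G H : groupType) (f : {multiplicative G ->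
  H}) :
  bijective f -> group_isomorphic H G.
Proof.
move=> [g fK gK]; pose gm : {multiplicative H -> G} :=
  HB.pack_for {multiplicative H -> G} g
    (isMultiplicative.Build H G g (can2_gmulfM fK gK)).
by exists gm; exists f.
Qed.

Section AbelianPair.
Variables (A : zmodType) (X : finType).
Variables (coord : X -> A -> int) (md : X -> nat) (gen : X -> A).
Local Open Scope classical_set_scope.
Local Open Scope ring_scope.
Hypothesis coordD : forall x a b,
  (md x %| coord x (a + b) - (coord x a + coord x b))%Z.
Hypothesis coord_eq : forall a b,
  (forall x, (md x %| coord x a - coord x b)%Z) -> a = b.
Hypothesis coord_gen : forall x y, (md x %| coord x (gen y) - (x == y)%:R)%Z.
Variables (Nl : pred X) (N : normal_subgroup (mulgrp A)).
Hypothesis N_coord : forall a : A,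
  (N : set (mulgrp A)) a <-> forall x, ~~ Nl x -> (md x %| coord x a)%Z.
Variables (F : groupType) (B : set F) (p : {multiplicative F -> mulgrp A}).
Hypothesis freeB : free_basis B.
Hypothesis p_surj : forall g, exists y, p y = g.
Variable c : nat.
Hypothesis c_gt0 : (0 < c)%N.

Local Notation T := 'I_#|X|.
Local Notation R := (pres_ker p).
Local Notation S := (pres_pre p N).

(** The alphabet is ['I_#|X|] because Lyndon words need a total order on letters. *)
Definition letter_lift (j : T) : F := projT1 (cid (p_surj (gen (enum_val j)))).

Lemma p_letter_lift j : p (letter_lift j) = gen (enum_val j).
Proof. exact: projT2 (cid (p_surj (gen (enum_val j)))). Qed.

Let pM y z : p (y * z)%g = (p y : A) + (p z : A). Proof. exact: gmulfM. Qed.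
Let p1 : p 1%g = 0 :> A. Proof. exact: (mult_morph1 p). Qed.
Let pV y : p y^-1%g = - (p y : A). Proof. exact: (mult_morphV p). Qed.

Lemma commutator_pres_ker : commutator setT setT `<=` R.
Proof.
apply: smallest_sub; first exact: (pres_ker_normal p).1.
move=> _ [y [z [_ _ ->]]]; rewrite /pres_ker /= /commg /conjg !pM !pV.
by rewrite [X in - _ + (_ + X)]addrC addKr addNr.
Qed.

(** Modulo [R], [y] is a product of powers of lifts with the coordinates of [p y] as exponents.
    Taking [Q] to be all letters treats [F]; [Q = Nl] treats [S], where the remaining terms
    vanish. *)
Lemma pres_generated (H : set F) (Q : pred X) y : is_subgroup H -> R `<=` H ->
  (forall j, Q (enum_val j) -> H (letter_lift j)) ->
  (forall x, ~~ Q x -> gen x *~ coord x (p y) = 0) -> H y.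
Proof.
move=> sH RH HQ Q0; pose pH (a : A) := exists2 z, H z & p z = a.
have pH0 : pH 0 by exists 1%g; rewrite ?p1 //; apply: is_subgroup1.
have pHD a b : pH a -> pH b -> pH (a + b).
  by move=> [z Hz <-] [z' Hz' <-]; exists (z * z')%g; rewrite ?pM //;
    apply: is_subgroupM.
have pHN a : pH a -> pH (- a).
  by move=> [z Hz <-]; exists z^-1%g; rewrite ?pV //; apply: is_subgroupV.
have pHMn a n : pH a -> pH (a *+ n).
  by move=> Ha; elim: n => [|n IHn]; rewrite ?mulr0n // mulrS; apply: pHD.
have pHMz a n : pH a -> pH (a *~ n).
  by case: n => n Ha; [apply: pHMn | rewrite NegzE mulrNz; apply/pHN/pHMn].
have [z Hz pz] : pH (p y).
  rewrite (coord_decomp coordD coord_eq coord_gen (p y));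
    elim/big_ind: _ => // x _.
  have [Qx|/Q0 -> //] := boolP (Q x); apply: pHMz.
  exists (letter_lift (enum_rank x)); first by apply: HQ; rewrite enum_rankK.
  by rewrite p_letter_lift enum_rankK.
rewrite -(mulgVK z y); apply: is_subgroupM sH _ Hz; apply: RH.
by rewrite /pres_ker /= pM pV pz; apply: subrr.
Qed.

Variables (q : seq T -> nat) (I : seq (seq T)).
Hypothesis q_dvd : forall w j, j \in w -> (q w %| md (enum_val j))%N.
Hypothesis q_mem : forall w, w != [::] -> exists2 j, j \in w & md (enum_val j)
  = q w.
Hypothesis q_perm : forall v w, perm_eq v w -> q v = q w.
Hypothesis uI : uniq I.
Hypothesis mem_I : forall w : seq T,
  w \in I <-> num_words (fun j => Nl (enum_val j)) c w.
(** The three hypotheses on [lift] characterize [D] as the sum over [w] in [I] of cyclic groups of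
    modulus [q w], without fixing how the summands are grouped. *)
Variables (D : zmodType) (lift : D -> seq T -> int).
Hypothesis liftD : forall a b w, w \in I ->
  (q w %| lift (a + b) w - (lift a w + lift b w))%Z.
Hypothesis lift_inj : forall a b,
  (forall w, w \in I -> (q w %| lift a w - lift b w)%Z) -> a = b.
Hypothesis lift_surj : forall z : seq T -> int, exists a,
  forall w, w \in I -> (q w %| lift a w - z w)%Z.

Local Notation NlT := (fun j : T => Nl (enum_val j)).
Local Notation nR := (pres_ker_normal p).
Local Notation nS := (pres_pre_normal p N).
Local Notation num := (iter_commutator S setT c).
Local Notation den := (iter_commutator R setT c).

Let genF : setT `<=` generated (range letter_lift `|` R).
Proof.
move=> y _; apply: (pres_generated (Q := xpredT)) => //.
- exact: generated_subgroup.
- by move=> z Rz; apply: sub_gen_smallest; right.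
- by move=> j _; apply: sub_gen_smallest; left; exists j.
Qed.

Let genS : S `<=`
  generated ([set letter_lift j | j in [set j : T | Nl (enum_val j)]] `|` R).
Proof.
move=> y Sy; apply: (pres_generated (Q := Nl)) => //.
- exact: generated_subgroup.
- by move=> z Rz; apply: sub_gen_smallest; right.
- by move=> j Nj; apply: sub_gen_smallest; left; exists j.
move=> x nx; have /dvdzP[t ->] := (N_coord (p y)).1 Sy x nx.
by rewrite mulrC mulrzA -pmulrn (gen_order coordD coord_eq coord_gen) mul0rz.
Qed.

Let xS j : Nl (enum_val j) -> S (letter_lift j).
Proof.
move=> Nj; rewrite /pres_pre /= p_letter_lift; apply/N_coord => x nx.
have := coord_gen x (enum_val j); case: eqP => [e|_]; last by rewrite subr0.
by rewrite e Nj in nx.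
Qed.

Let xR j : R (letter_lift j ^+ md (enum_val j))%g.
Proof.
rewrite /pres_ker /=;
  have pX k : p (letter_lift j ^+ k)%g = (gen (enum_val j) *+ k : A).
  elim: k => [|k IHk]; first by rewrite mulr0n expg0 p1.
  by rewrite expgS pM p_letter_lift IHk mulrS.
by rewrite pX (gen_order coordD coord_eq coord_gen).
Qed.

Let al (j : T) y := coord (enum_val j) (p y).

Let alM j y z : (md (enum_val j) %| (al j (y * z)%g - (al j y + al j z))%R)%Z.
Proof. by rewrite /al pM; apply: coordD. Qed.

Let al_x i j : (md (enum_val i) %| (al i (letter_lift j) - (i == j)%:R)%R)%Z.
Proof.
rewrite /al p_letter_lift; have := coord_gen (enum_val i) (enum_val j).
by rewrite (inj_eq enum_val_inj).
Qed.

Let al_R j y : R y -> (md (enum_val j) %| al j y)%Z.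
Proof.
by move=> py; rewrite /al (_ : p y = 0 :> A) //; apply: (coord_zero coordD).
Qed.

Let q_mem' w : w != [::] -> exists2 j : T, j \in w & (fun j => md (enum_val j))
  j = q w.
Proof. exact: q_mem. Qed.

Let cR := commutator_pres_ker.
Let lp := lyndon_prod letter_lift I.

(** The condition [c > 0] enters here: one bracket puts the numerator inside [R], so the
    intersection with [R] is automatic. *)
Let num_ker y : num y -> R y.
Proof.
move=> /iter_commutator_gam; case: (c) c_gt0 => // k _ /(gamS_den cR).
exact: (iter_commutator_normal_sub nR).
Qed.

Let lp_mem z : lp z \in (multiplier_num p N c : set F).
Proof.
apply: mem_set; have lpn : num (lp z) by exact: (lyndon_prod_num (Nl := NlT) nS
  xS mem_I z).
by split=> //; apply: num_ker.
Qed.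

Let lp_sub z : subgroup_type (multiplier_num p N c) := exist _ (lp z) (lp_mem
  z).

Let toM (a : mulgrp D) : nilpotent_multiplier p N c :=
  quot_map (multiplier_den p N c) (lp_sub (lift a)).

Let pi := quot_map (NormalSubgroup (den_normal nR c)).

(** Transfers equality in the multiplier, a quotient of a subgroup type, to the quotient of [F]
    itself, where the Lyndon products are compared. *)
Let quot_eq (u v : subgroup_type (multiplier_num p N c)) :
  quot_map (multiplier_den p N c) u = quot_map (multiplier_den p N c) v <->
  pi (val u) = pi (val v).
Proof. by rewrite !quot_mapP. Qed.

Let lpE z z' : pi (lp z) = pi (lp z') <->
  forall w, w \in I -> (q w %| (z w - z' w)%R)%Z.
Proof.
exact: (lyndon_prod_eq freeB nR cR xR alM al_x al_R q_dvd q_mem' q_perm uI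
  mem_I).
Qed.

Theorem abelian_pair_multiplier :
  group_isomorphic (nilpotent_multiplier p N c) (mulgrp D).
Proof.
have toM_M : {morph toM : a b / (a * b)%g}.
  move=> a b; rewrite /toM -quot_mapM.
  apply/quot_eq; rewrite /= /pi quot_mapM.
  rewrite -(lyndon_prodD letter_lift nR cR mem_I (lift a) (lift b)).
  by apply/lpE => w Iw; apply: liftD.
pose f : {multiplicative mulgrp D -> nilpotent_multiplier p N c} :=
  HB.pack_for {multiplicative mulgrp D -> nilpotent_multiplier p N c} toM
    (isMultiplicative.Build _ _ toM toM_M).
apply: (@bijective_group_isomorphic _ _ f).
have f_inj : injective f.
  by move=> a b /quot_eq /lpE; apply: lift_inj.
have f_surj u : exists a, f a = u.
  have [y <-] := quot_map_surj u; have [_ ny] := set_mem (valP y).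
  have [z yz] := num_lyndon_prod (Nl := NlT) nR cR genF genS uI mem_I ny.
  have [a az] := lift_surj z; exists a; apply/quot_eq.
  by apply: etrans _ (esym yz); apply/lpE.
pose g u := projT1 (cid (f_surj u)).
have gK : cancel g f by move=> u; apply: projT2 (cid (f_surj u)).
by exists g => // a; apply: f_inj; rewrite gK.
Qed.

End AbelianPair.

(** * Grouping cyclic summands by torsion index *)

Section ClassSum.
Variables (U : finType) (A : {set U}) (cl : U -> nat) (n : nat) (r : nat ->
  nat).
Hypothesis r_gt0 : forall i, (i < n)%N -> (0 < r i.+1)%N.
Hypothesis cl_le : forall u, (cl u <= n)%N.
Local Open Scope ring_scope.

Definition chain_mod i : nat := if (i < n)%N then r i.+1 else 0.

Definition cls i := [set u in A | cl u == i].

(** Class [n] is the free part and comes first, as exponent 0; class [i < n] has modulus [r i.+1]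
    and becomes exponent [i.+1]. *)
Definition cls_card k := if k is i.+1 then #|cls i| else #|cls n|.

Local Notation e := cls_card.
Local Notation D := (copies int (e 0) *
  direct_sum (fun i : 'I_n => copies (cyc (r i.+1)) (e i.+1)))%type.
Implicit Types (a b : D) (u : U).

Definition free_part a (k : 'I_(e 0)) : int := (a.1 : copies int (e 0)) k.
Definition tors_part a (i : 'I_n) (k : 'I_(e i.+1)) : cyc (r i.+1) :=
  ((a.2 : direct_sum (fun i : 'I_n => copies (cyc (r i.+1)) (e i.+1))) i
     : copies (cyc (r i.+1)) (e i.+1)) k.

(** An element is located by its position in the enumeration of its class; the value 0 is a default
    outside [A]. *)
Definition cls_coord a u : int :=
  if (insub (cl u) : option 'I_n) is Some i then
    if (insub (index u (enum (cls i))) : option 'I_(e i.+1)) is Some k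
    then (val (@tors_part a i k))%:Z else 0
  else if (insub (index u (enum (cls n))) : option 'I_(e 0)) is Some k
       then free_part a k else 0.

Lemma cls_coordD a b u :
  (chain_mod (cl u) %| cls_coord (a + b) u - (cls_coord a u + cls_coord b u))%Z.
Proof.
rewrite /cls_coord /chain_mod; case: insubP => [i iu def_i|niu].
  rewrite iu -def_i; case: insubP => [k _ _|_]; last by rewrite subrr.
  have -> : @tors_part (a + b) i k = @tors_part a i k + @tors_part b i k.
    by rewrite /tors_part /= !ffunE.
  by apply: cycD; apply: r_gt0.
case: insubP => [k _ _|_]; last by rewrite subrr.
by rewrite /free_part /= !ffunE subrr.
Qed.

Lemma index_enum_val (B : {set U}) (k : 'I_#|B|) : index (enum_val k) (enum B)
  = k.
Proof.
rewrite /enum_val index_uniq ?enum_uniq // -cardE.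
exact: ltn_ord.
Qed.

Lemma cls_coord_tors a (i : 'I_n) (k : 'I_(e i.+1)) :
  cls_coord a (@enum_val _ (mem (cls i)) k) = (val (@tors_part a i k))%:Z.
Proof.
have := enum_valP k; rewrite inE => /andP[_ /eqP cli].
rewrite /cls_coord cli valK (index_enum_val (B := cls i)).
by rewrite (_ : insub _ = Some k) // -[in RHS](valK k).
Qed.

Lemma cls_coord_free a (k : 'I_(e 0)) :
  cls_coord a (@enum_val _ (mem (cls n)) k) = free_part a k.
Proof.
have := enum_valP k; rewrite inE => /andP[_ /eqP cli].
rewrite /cls_coord cli insubN ?ltnn // (index_enum_val (B := cls n)).
by rewrite (_ : insub _ = Some k) // -[in RHS](valK k).
Qed.

Lemma cls_coord_inj a b :
  (forall u, u \in A -> (chain_mod (cl u) %| cls_coord a u - cls_coord b u)%Z)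
    ->
  a = b.
Proof.
move=> H; suff [Hf Ht] : free_part a =1 free_part b /\
    forall i, @tors_part a i =1 @tors_part b i.
  case: a b H Hf Ht => [a1 a2] [b1 b2] _ Hf Ht; congr (_, _).
    by apply/ffunP=> k; apply: Hf.
  by apply/ffunP=> i; apply/ffunP=> k; apply: Ht.
split=> [k|i k].
  have := enum_valP k; rewrite inE => /andP[Ak /eqP cli].
  have := H _ Ak; rewrite !cls_coord_free cli /chain_mod ltnn dvd0z subr_eq0.
  by move/eqP.
have := enum_valP k; rewrite inE => /andP[Ak /eqP cli].
have := H _ Ak; rewrite !cls_coord_tors cli /chain_mod ltn_ord.
by apply: cyc_eq; apply: r_gt0.
Qed.

Lemma cls_coord_surj (z : U -> int) : exists a,
  forall u, u \in A -> (chain_mod (cl u) %| cls_coord a u - z u)%Z.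
Proof.
exists ([ffun k => z (@enum_val _ (mem (cls n)) k)],
  [ffun i : 'I_n => [ffun k => cyc_of (r i.+1) (z (@enum_val _ (mem (cls i))
    k))]]).
move=> u Au; have uC : u \in cls (cl u) by rewrite inE Au eqxx.
have := cl_le u; rewrite leq_eqVlt => /predU1P[cln|cln].
  rewrite cln in uC; have [k ->] : exists k : 'I_(e 0), u = @enum_val _ (mem
    (cls n)) k.
    by exists (enum_rank_in uC u); rewrite enum_rankK_in.
  by rewrite cls_coord_free /free_part /= ffunE subrr.
pose i := Ordinal cln.
have [k ->] : exists k : 'I_(e i.+1), u = @enum_val _ (mem (cls i)) k.
  by exists (enum_rank_in uC u); rewrite enum_rankK_in.
rewrite cls_coord_tors /tors_part /= !ffunE.
have := enum_valP k; rewrite inE => /andP[_ /eqP ->].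
by rewrite /chain_mod ltn_ord; apply: cyc_ofE; apply: r_gt0.
Qed.

End ClassSum.

(** * The alphabet of the pair and the counts of its words *)

Section Letters.
Variables (l s t n : nat) (r : nat -> nat).
Hypothesis le_tn : (t <= n)%N.
Hypothesis r_gt0 : forall i, (i < n)%N -> (0 < r i.+1)%N.
Hypothesis r_dvd : forall i, (i.+1 < n)%N -> (r i.+1 %| r i.+2)%N.
Local Open Scope ring_scope.

Definition letter : finType := (('I_l + 'I_t) + ('I_s + 'I_(n - t)))%type.
Implicit Types x y : letter.

Definition in_N x := if x is inl _ then true else false.

(* Torsion summands are numbered from 0; [n] stands for an infinite one. *)
Definition tors_idx x : nat :=
  match x with
  | inl (inr i) => i
  | inr (inr i) => t + i
  | _ => n
  end.

Lemma tors_idx_le x : (tors_idx x <= n)%N.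
Proof. by case: x => [[|i]|[|i]] //=; have := ltn_ord i; lia. Qed.

(** The modulus 0 at index [n] and beyond is divisible by all others, so it closes the chain. *)
Lemma chain_mod_dvd i j : (i <= j)%N -> (chain_mod n r i %| chain_mod n r j)%N.
Proof.
move=> ij; rewrite /chain_mod; case: (ltnP j n) => [jn'|_]; last exact: dvdn0.
rewrite (leq_ltn_trans ij jn').
elim: j ij jn' => [|j IHj]; first by rewrite leqn0 => /eqP ->.
rewrite leq_eqVlt => /predU1P[->//|]; rewrite ltnS => ij jn.
exact: dvdn_trans (IHj ij (ltnW jn)) (r_dvd jn).
Qed.

Local Notation N := (fg_abelian l t (fun i => r i.+1)).
Local Notation K := (fg_abelian s (n - t)%N (fun i => r (t + i).+1%N)).
Local Notation NK := (N * K)%type.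

Let qN_gt0 (i : 'I_t) : (0 < r i.+1)%N.
Proof. by apply: r_gt0; have := ltn_ord i; lia. Qed.

Let qK_gt0 (i : 'I_(n - t)) : (0 < r (t + i).+1)%N.
Proof. by apply: r_gt0; have := ltn_ord i; lia. Qed.

Definition letter_coord x (g : NK) : int :=
  match x with
  | inl y => fg_coord (y : 'I_l + 'I_t) (g.1 : N)
  | inr y => fg_coord (y : 'I_s + 'I_(n - t)) (g.2 : K)
  end.

Definition letter_gen x : NK :=
  match x with
  | inl y => (fg_gen _ (y : 'I_l + 'I_t), 0)
  | inr y => (0, fg_gen _ (y : 'I_s + 'I_(n - t)))
  end.

Definition letter_mod x : nat := chain_mod n r (tors_idx x).

Lemma letter_modE x : letter_mod x =
  match x with
  | inl y => fg_mod (fun i => r i.+1) (y : 'I_l + 'I_t)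
  | inr y => fg_mod (fun i => r (t + i).+1) (y : 'I_s + 'I_(n - t))
  end.
Proof.
rewrite /letter_mod /chain_mod; case: x => [[i|i]|[i|i]] /=; rewrite ?ltnn //.
  by rewrite (leq_trans (ltn_ord i)).
by have iK := ltn_ord i; rewrite ifT //; lia.
Qed.

Lemma letter_coordD x (g h : NK) : (letter_mod x %|
  letter_coord x (g + h) - (letter_coord x g + letter_coord x h))%Z.
Proof. by rewrite letter_modE; case: x => y /=; apply: fg_coordD. Qed.

Lemma letter_coord_eq (g h : NK) :
  (forall x, (letter_mod x %| letter_coord x g - letter_coord x h)%Z) -> g = h.
Proof.
move=> H; case: g h H => [g1 g2] [h1 h2] H; congr (_, _).
  apply: fg_coord_eq => [|y]; first exact: qN_gt0.
  by have := H (inl y); rewrite letter_modE.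
apply: fg_coord_eq => [|y]; first exact: qK_gt0.
by have := H (inr y); rewrite letter_modE.
Qed.

Lemma letter_coord_gen x y :
  (letter_mod x %| letter_coord x (letter_gen y) - (x == y)%:R)%Z.
Proof.
rewrite letter_modE; case: x => x; case: y => y /=.
- exact: fg_coord_of.
- by rewrite fg_coord0 subr0.
- by rewrite fg_coord0 subr0.
- exact: fg_coord_of.
Qed.

Lemma left_factor_coord (g : NK) :
  (left_factor N K : set (mulgrp NK)) g <->
  forall x, ~~ in_N x -> (letter_mod x %| letter_coord x g)%Z.
Proof.
split=> [g0 [//|y] _|H].
  by rewrite letter_modE /= (_ : g.2 = 0) // fg_coord0.
apply: (@fg_coord_eq _ _ (fun i => r (t + i).+1)) => [|y]; first exact: qK_gt0.
by have := H (inr y) isT; rewrite letter_modE /= fg_coord0 subr0.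
Qed.

Local Notation T := 'I_#|letter|.

(** If no torsion letter occurs, [find] returns the length [n] of the list, which is exactly the
    index of the free class. *)
Definition word_idx (w : seq T) : nat :=
  find (fun i => has (fun j => tors_idx (enum_val j) == i) w) (iota 0 n).

Definition word_mod w := chain_mod n r (word_idx w).

Lemma word_idx_le w : (word_idx w <= n)%N.
Proof. by rewrite -[X in (_ <= X)%N](size_iota 0) find_size. Qed.

Lemma word_idx_perm v w : perm_eq v w -> word_idx v = word_idx w.
Proof. by move=> pvw; apply: eq_find => i; apply: perm_has. Qed.

Lemma word_idx_min w j : j \in w -> (word_idx w <= tors_idx (enum_val j))%N.
Proof.
move=> jw; have := tors_idx_le (enum_val j);
  rewrite leq_eqVlt => /predU1P[->|lt].
  exact: word_idx_le.
rewrite leqNgt; apply/negP => /(before_find 0%N); rewrite nth_iota // add0n.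
by move/hasPn/(_ j jw); rewrite eqxx.
Qed.

Lemma word_idx_mem w : w != [::] ->
  exists2 j, j \in w & tors_idx (enum_val j) = word_idx w.
Proof.
move=> w0; have [lt|] := boolP (has (fun i =>
    has (fun j => tors_idx (enum_val j) == i) w) (iota 0 n)).
  have := nth_find 0%N lt; rewrite has_find size_iota in lt.
  by rewrite nth_iota // => /hasP[j jw /eqP ej]; exists j.
move=> H; have := H; rewrite has_find -leqNgt size_iota => nle.
case: w w0 H nle => // j w _ /hasPn H nle; exists j; first exact: mem_head.
apply/eqP; rewrite eqn_leq (leq_trans (tors_idx_le _) nle) word_idx_min
  ?mem_head //.
Qed.

(** Turns a bound on the class of a word into a restriction of its alphabet, to which the Lyndon
    count applies. *)
Lemma word_idx_geP w i : (i <= n)%N ->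
  (i <= word_idx w)%N = all (fun j => i <= tors_idx (enum_val j))%N w.
Proof.
move=> i_n; apply/idP/allP => [iw j jw|H];
  first exact: leq_trans (word_idx_min jw).
have [->|w0] := eqVneq w [::].
  rewrite /word_idx hasNfind ?size_iota //; apply/hasPn=> k _.
  by [].
by have [j jw <-] := word_idx_mem w0; apply: H.
Qed.

Lemma card_enum_val (X : finType) (P : pred X) :
  #|[pred j : 'I_#|X| | P (enum_val j)]| = #|P|.
Proof.
rewrite -!sum1_card [RHS](reindex _ (onW_bij _ (@enum_val_bij X))).
by apply: eq_bigl => j; rewrite inE.
Qed.

Lemma card_ord_geq k i : #|[pred j : 'I_k | (i <= j)%N]| = (k - i)%N.
Proof.
have E : (\sum_(j < k | i <= j) 1 = k - i)%N.
  elim: k => [|k IHk]; first by rewrite big_ord0.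
  by rewrite big_mkcond big_ord_recr /= -big_mkcond IHk; case: leqP; lia.
by rewrite -sum1_card -E; apply: eq_bigl => j; rewrite inE.
Qed.

Definition idx_ge i : pred T := fun j => (i <= tors_idx (enum_val j))%N.
Definition K_idx_ge i : pred T :=
  fun j => (i <= tors_idx (enum_val j))%N && ~~ in_N (enum_val j).

Lemma card_sum_pred (X Y : finType) (P : pred (X + Y)) :
  #|P| = (#|[pred x | P (inl x)]| + #|[pred y | P (inr y)]|)%N.
Proof. by rewrite -!sum1_card big_sumType. Qed.

Lemma card_idx_ge i : (i <= n)%N -> #|idx_ge i| = (l + s + n - i)%N.
Proof.
move=> i_n; rewrite (@card_enum_val letter (fun x => i <= tors_idx x)%N).
rewrite !card_sum_pred /=.
have E k : #|[pred _ : 'I_k | (i <= n)%N]| = k.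
  by rewrite -[RHS]card_ord; apply: eq_card => j; rewrite !inE i_n.
rewrite !E card_ord_geq.
have -> : #|[pred y : 'I_(n - t) | (i <= t + y)%N]| = (n - t - (i - t))%N.
  by rewrite -(card_ord_geq (n - t) (i - t)); apply: eq_card => j;
    rewrite !inE; lia.
lia.
Qed.

(** The truncated [i - t] covers both cases: for [i <= t] all torsion letters of [K] are counted. *)
Lemma card_K_idx_ge i : (i <= n)%N -> #|K_idx_ge i| = (s + (n - t - (i - t)))%N.
Proof.
move=> i_n; rewrite (@card_enum_val letter (fun x => (i <= tors_idx x) && ~~
  in_N x)%N).
rewrite !card_sum_pred /=.
have E0 (k : finType) (P : pred k) : #|[pred x | P x && false]| = 0.
  by rewrite eq_card0 // => j; rewrite !inE andbF.
rewrite (@E0 _ (fun=> i <= n)%N) (@E0 _ (fun x : 'I_t => i <= x)%N) add0n.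
have -> : #|[pred x : 'I_s | (i <= n)%N && ~~ false]| = s.
  by rewrite -[RHS]card_ord; apply: eq_card => j; rewrite !inE i_n.
congr (_ + _)%N; rewrite -(card_ord_geq (n - t) (i - t)); apply: eq_card => j;
  rewrite !inE andbT; lia.
Qed.

Section Counting.
Variable c : nat.

Definition num_tuples : {set c.+1.-tuple T} :=
  [set u : c.+1.-tuple T | lyndon u && has (fun j => in_N (enum_val j)) u].

Local Notation cls := (cls num_tuples (fun u => word_idx u)).
Local Notation LW P := (lyndon_words P c.+1).

Let all_K i (u : seq T) : (i <= n)%N ->
  all (K_idx_ge i) u = (i <= word_idx u)%N && ~~ has (fun j => in_N (enum_val
    j)) u.
Proof. by move=> i_n; rewrite word_idx_geP // -all_predC -all_predI. Qed.

Let sum_card (B : {set c.+1.-tuple T}) : #|B| = (\sum_u (u \in B))%N.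
Proof. by rewrite -sum1_card big_mkcond. Qed.

(** Words of index exactly [i] are those of index at least [i] minus those of index at least
    [i + 1]; from these the ones using only letters of [K] are removed in the same way. Written
    without subtraction, as it would truncate. *)
Lemma card_cls i : (i < n)%N ->
  (#|cls i| + #|LW (idx_ge i.+1)| + #|LW (K_idx_ge i)| =
   #|LW (idx_ge i)| + #|LW (K_idx_ge i.+1)|)%N.
Proof.
move=> i_n; rewrite !sum_card -!big_split; apply: eq_bigr => u _.
rewrite !inE !all_K ?(ltnW i_n) // -!word_idx_geP ?(ltnW i_n) //=.
by case: (lyndon u) => //=; case: (has _ _) => //=; lia.
Qed.

Lemma card_cls_n : (#|cls n| + #|LW (K_idx_ge n)| = #|LW (idx_ge n)|)%N.
Proof.
rewrite !sum_card -big_split; apply: eq_bigr => u _.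
rewrite !inE !all_K // -!word_idx_geP //=; have := word_idx_le u.
by case: (lyndon u) => //=; case: (has _ _) => //=; lia.
Qed.

End Counting.

End Letters.

(** * The isomorphism and its exponents *)

Section FinalIsomorphism.
Variables (c l s t n : nat) (r : nat -> nat).
Hypothesis c_gt0 : (0 < c)%N.
Hypothesis le_tn : (t <= n)%N.
Hypothesis r_gt0 : forall i, (i < n)%N -> (0 < r i.+1)%N.
Hypothesis r_dvd : forall i, (i.+1 < n)%N -> (r i.+1 %| r i.+2)%N.
Local Open Scope ring_scope.
Local Notation N := (fg_abelian l t (fun i => r i.+1)).
Local Notation K := (fg_abelian s (n - t)%N (fun i => r (t + i).+1%N)).
Variables (F : groupType) (p : {multiplicative F -> mulgrp (N * K)%type}).
Hypothesis pres : free_presentation p.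

Local Notation T := 'I_#|letter l s t n|.
Local Notation A := (num_tuples l s t n c).
Local Notation idx := (fun u : c.+1.-tuple T => word_idx u).
Local Notation e := (cls_card A idx n).
Local Notation D := (copies int (e 0%N) *
  direct_sum (fun i : 'I_n => copies (cyc (r i.+1)) (e i.+1)))%type.

Let lift (a : D) (w : seq T) : int :=
  if (insub w : option (c.+1.-tuple T)) is Some u then cls_coord a u else 0.

Let words : seq (seq T) := [seq val u | u <- enum A].

Lemma multiplier_iso_classes :
  group_isomorphic (nilpotent_multiplier p (left_factor N K) c) (mulgrp D).
Proof.
have [[B freeB] p_surj] := pres.
have liftE a u : lift a (val u) = cls_coord a u by rewrite /lift valK.
have wordsP w : w \in words -> exists2 u, u \in A & w = val u.
  by case/mapP=> u; rewrite mem_enum => Au ->; exists u.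
have idx_le (u : c.+1.-tuple T) : (idx u <= n)%N by apply: word_idx_le.
apply: (abelian_pair_multiplier (letter_coordD le_tn r_gt0)
  (letter_coord_eq le_tn r_gt0) (letter_coord_gen le_tn r_gt0)
  (left_factor_coord le_tn r_gt0) freeB p_surj c_gt0
  (q := fun w => word_mod r w) (I := words) _ _ _ _ _ (lift := lift) _ _ _).
- by move=> w j jw; apply: chain_mod_dvd r_dvd _ _ (word_idx_min le_tn jw).
- by move=> w w0; have [j jw E] := word_idx_mem le_tn w0; exists j;
  rewrite // /letter_mod E.
- by move=> v w pvw; rewrite /word_mod (word_idx_perm pvw).
- by rewrite map_inj_uniq ?enum_uniq //; apply: val_inj.
- move=> w; split=> [/wordsP[u]|[lw sw hw]].
    by rewrite inE => /andP[lu hu] ->; split; rewrite // size_tuple.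
  have /eqP sw' := sw; apply/mapP; exists (Tuple sw') => //.
  by rewrite mem_enum inE lw.
- move=> a b w /wordsP[u _ ->]; rewrite !liftE.
  exact: (@cls_coordD _ A idx n r r_gt0 a b u).
- move=> a b H; apply: (@cls_coord_inj _ A idx n r r_gt0) => u Au.
  by rewrite -!liftE; apply: H; apply/mapP; exists u; rewrite ?mem_enum.
- move=> z; have [a aP] := @cls_coord_surj _ A idx n r r_gt0 idx_le (fun u => z
  (val u)).
  by exists a => w /wordsP[u Au ->]; rewrite liftE; apply: aP.
Qed.

Lemma cls_card_free : (e 0%N)%:R = witt c.+1 (l + s) - witt c.+1 s.
Proof.
have := congr1 (fun k => k%:R : rat) (card_cls_n l s le_tn c).
rewrite natrD !card_lyndon_words // card_K_idx_ge // card_idx_ge //.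
have -> : (s + (n - t - (n - t)) = s)%N by lia.
by rewrite addnK => <-; rewrite addrK.
Qed.

Lemma cls_card_tors i : (i < n)%N ->
  (e i.+1)%:R = witt c.+1 (l + s + n - i) - witt c.+1 (l + s + n - i.+1)
   - (witt c.+1 (s + (n - t - (i - t))) - witt c.+1 (s + (n - t - (i.+1 - t)))).
Proof.
move=> i_n; have := congr1 (fun k => k%:R : rat) (card_cls l s le_tn c i_n).
rewrite !natrD !card_lyndon_words // !card_K_idx_ge ?(ltnW i_n) //.
rewrite !card_idx_ge ?(ltnW i_n) // => E.
rewrite /cls_card; move: E; set x := (#|_|%:R : rat) => E.
have -> : x = x + witt c.+1 (l + s + n - i.+1) +
    witt c.+1 (s + (n - t - (i - t))) - witt c.+1 (l + s + n - i.+1) -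
    witt c.+1 (s + (n - t - (i - t))) by ring.
by rewrite E; ring.
Qed.

End FinalIsomorphism.

Local Open Scope ring_scope.

(* The exponents f_0, f_i and f_i - g_i are rationals by Witt's formula; e
   asserts that they are natural numbers. *)
Theorem theorem2p4 (c l s t n : nat) (r : nat -> nat)
    (c_ge1 : (1 <= c)%N) (le_tn : (t <= n)%N)
    (r_gt0 : forall i, (1 <= i <= n)%N -> (0 < r i)%N)
    (r_dvd : forall i, (1 <= i <= n.-1)%N -> (r i %| r i.+1)%N)
    (N := fg_abelian l t (fun i => r i.+1))
    (K := fg_abelian s (n - t)%N (fun i => r (t + i).+1%N))
    (G := mulgrp (N * K)%type)
    (m := (l + s)%N)
    (f0 := witt c.+1 m - witt c.+1 (m - l)%N)
    (f := fun i : nat =>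
       witt c.+1 (m + n - i + 1)%N - witt c.+1 (m + n - i)%N)
    (g := fun i : nat =>
       witt c.+1 (m + n - l - i + 1)%N - witt c.+1 (m + n - l - i)%N)
    (F : groupType) (p : {multiplicative F -> G})
    (pres : free_presentation p) :
  exists e : nat -> nat,
    [/\ (e 0%N)%:R = f0,
        forall i, (1 <= i <= t)%N -> (e i)%:R = f i,
        forall i, (t.+1 <= i <= n)%N -> (e i)%:R = f i - g i &
        group_isomorphic (nilpotent_multiplier p (left_factor N K) c)
          (mulgrp (copies int (e 0%N)
             * direct_sum (fun i : 'I_n => copies (cyc (r i.+1)) (e i.+1)))%type)].
Proof.
have r_gt0' i : (i < n)%N -> (0 < r i.+1)%N by move=> i_n; apply: r_gt0; lia.
have r_dvd' i : (i.+1 < n)%N -> (r i.+1 %| r i.+2)%N by move=> i_n;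
  apply: r_dvd; lia.
exists (cls_card (num_tuples l s t n c) (fun u : c.+1.-tuple _ => word_idx u)
  n).
split; last exact: multiplier_iso_classes.
- by rewrite cls_card_free // /f0 /m addKn.
(* For [i < t] both truncated differences [i - t] and [i.+1 - t] are 0: removing a torsion letter of
   [N] leaves the alphabet of [K] unchanged, so no [g] term appears. *)
- case=> // i /andP[_ it]; rewrite cls_card_tors //; last by lia.
  have -> : (n - t - (i - t) = n - t - (i.+1 - t))%N by lia.
  rewrite subrr subr0 /f /m; congr (witt _ _ - witt _ _)%R; lia.
- case=> // i /andP[ti i_n]; rewrite cls_card_tors // /f /g /m.
  congr (witt _ _ - witt _ _ - (witt _ _ - witt _ _))%R; lia.
Qed.
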